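(* Let $f_1,\dots,f_k\in\mathbb{R}[x_1,\dots,x_d]$, let $\mathcal{K}(\mathsf f)=\{x\in\mathbb{R}^d: f_1(x)\ge0,\dots,f_k(x)\ge0\}$, and let $T(\mathsf f)$ be the preordering generated by $f_1,\dots,f_k$. Let $h\in\mathbb{R}[x_1,\dots,x_d]$. If the set $\mathcal{K}(\mathsf f)$ is compact and $h(x)>0$ for all $x\in\mathcal{K}(\mathsf f)$, then $h\in T(\mathsf f)$.
   Context: $\sum\mathbb{R}[x_1,\dots,x_d]^2$ denotes the set of finite sums of squares of polynomials in $\mathbb{R}[x_1,\dots,x_d]$. The preordering generated by $f_1,\dots,f_k$ is $T(\mathsf f)=\big\{\sum_{e\in\{0,1\}^k} f_1^{e_1}\cdots f_k^{e_k}\sigma_e:\ \sigma_e\in\sum\mathbb{R}[x_1,\dots,x_d]^2\big\}$. *)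

(* Defs.v *)
From HB Require Import structures.
From mathcomp Require Import all_boot all_order all_algebra.
From mathcomp Require Import boolp classical_sets reals topology normedtype.
(* The notations of multinomials clash with those of MathComp-Analysis; they
   are filtered out, but the canonical structures on mpoly are needed. *)
From mathcomp Require Import -(notations) mpoly.

Set Implicit Arguments.
Unset Strict Implicit.
Unset Printing Implicit Defensive.

Import Order.TTheory GRing.Theory Num.Theory.
Import numFieldNormedType.Exports.

Local Open Scope classical_set_scope.
Local Open Scope ring_scope.

Notation "{ 'mpoly' T [ n ] }" := (mpoly n T)
  (at level 0, T, n at level 2, format "{ 'mpoly'  T [ n ] }") : type_scope.

Section Preordering.
Context {R : realType} {d : nat}.

Definition mpeval (p : {mpoly R[d]}) (x : 'rV[R]_d) : R :=
  meval (fun i => x ord0 i) p.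

Definition sos : set {mpoly R[d]} :=
  [set p | exists s : seq {mpoly R[d]}, p = \sum_(q <- s) q ^+ 2].

Context {k : nat}.

Definition semialg (f : 'I_k -> {mpoly R[d]}) : set 'rV[R]_d :=
  [set x | forall i, 0 <= mpeval (f i) x].

(* The exponent vectors e in {0,1}^k are functions to bool; e i is coerced to
   nat in the exponent. *)
Definition preordering (f : 'I_k -> {mpoly R[d]}) : set {mpoly R[d]} :=
  [set p | exists2 sigma : {ffun 'I_k -> bool} -> {mpoly R[d]},
     (forall e, sos (sigma e)) &
     p = \sum_(e : {ffun 'I_k -> bool}) (\prod_(i < k) f i ^+ e i) * sigma e].

End Preordering.

(* Main.v *)
Require Import Defs.
From mathcomp Require Import all_boot all_order all_algebra.
From mathcomp Require Import boolp classical_sets reals topology normedtype.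
From mathcomp Require Import -(notations) mpoly.
From HB Require Import structures.
From mathcomp Require Import cardinality ereal lebesgue_measure.
From mathcomp Require Import polyorder polyrcf qe_rcf_th complex.
From mathcomp Require Import ring lra zify.
Import Order.TTheory GRing.Theory Num.Theory.
Import numFieldNormedType.Exports.

(** This is Schmuedgen's Positivstellensatz. Write T for the preordering of f
    and K for the set of points where all f_i are nonnegative. The argument has
    an algebraic half, which uses compactness only through one inequality, and
    a semialgebraic half, which produces denominators.

    Denominators. If g > 0 on K, then t g = 1 + s for some s, t in T
    (positive_certificate). Otherwise the preordering T - g T does not contain
    -1, while no point of K makes -g nonnegative; so it is enough to prove that
    a preordering of R[x] without -1 has points (weak_positivstellensatz): any
    finitely many of its members are nonnegative at a common real point.
    By Zorn's lemma such a preordering lies in a prime cone P, a preordering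
    that is total with prime support (prime_cone_extension), and P becomes an
    honest ordering over some real closed field S
    (real_closed_realization): there is a point sigma of S with p in P exactly
    when p(sigma) >= 0, for all polynomials p with integer coefficients in the
    coefficients of the f_i and in the variables. It remains to move from S
    back to R, one variable at a time (transfer_step): whether given
    polynomials in one variable have a common sign pattern somewhere on a real
    closed field depends only on the signs of finitely many expressions in
    their coefficients, by Sturm sequences and Tarski queries.

    The field S. The coefficients of finitely many polynomials generate a
    countable ring, so the support of P on it has a generic zero zeta with
    coordinates in the uncountable algebraically closed field R[i]
    (generic_extension). P then gives a cone in R[i], and a maximal cone there
    (maximal_precone_extension) is the positive cone of a real closed subfield
    (cone_field_ivt): if an irreducible polynomial changed sign without having
    a root, its root beta in R[i] could be adjoined to the ordered field, since
    an identity 1 + (weighted sum of squares) = 0 at beta would produce a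
    polynomial of smaller degree with the same sign change.

    Removing denominators. As K is compact, N - |x|^2 > 0 on K for some N, so
    t (N - |x|^2) = 1 + s. Woermann's trick turns this into N' - |x|^2 in T
    (archimedean_of_bounded), whence every polynomial is bounded by a constant
    modulo T (archimedean_preorder). For h > 0 on K, an identity t h = 1 + s
    and the bounds on t and t^2 h allow the constant r in h + r in T to be
    decreased by a fixed amount as long as it is nonnegative
    (positive_of_archimedean), until h itself is in T. *)

Set Implicit Arguments.
Unset Strict Implicit.
Unset Printing Implicit Defensive.

Local Open Scope classical_set_scope.
Local Open Scope ring_scope.

(** * Preorderings and prime cones of a commutative ring *)

Section PrimeCones.
Variable B : comNzRingType.
Implicit Types (T P : set B) (a b x y : B).

Definition is_preorder T :=
  [/\ forall x y, T x -> T y -> T (x + y),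
      forall x y, T x -> T y -> T (x * y) &
      forall x, T (x ^+ 2)].

(** The points of the real spectrum of B: the last clause says that the support,
    the elements x with x and - x in P, is a prime ideal. *)
Definition is_prime_cone P :=
  [/\ is_preorder P, ~ P (-1), forall x, P x \/ P (- x) &
      forall a b, P (a * b) -> P (- (a * b)) ->
        (P a /\ P (- a)) \/ (P b /\ P (- b))].

(** When T is a preordering this is the one generated by T and a: powers of a
    reduce modulo squares. *)
Definition adjoin T a : set B := [set x | exists s t, [/\ T s, T t & x = s + a * t]].

Lemma preorder0 T : is_preorder T -> T 0.
Proof. by case=> _ _ /(_ 0); rewrite expr0n. Qed.

Lemma preorder1 T : is_preorder T -> T 1.
Proof. by case=> _ _ /(_ 1); rewrite expr1n. Qed.

Lemma preorder_adjoin T a : is_preorder T -> is_preorder (adjoin T a).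
Proof.
move=> hT; have [TD TM TX] := hT; have T0 := preorder0 hT; split.
- move=> _ _ [s [t [Ts Tt ->]]] [u [v [Tu Tv ->]]].
  by exists (s + u), (t + v); split; [exact: TD|exact: TD|ring].
- move=> _ _ [s [t [Ts Tt ->]]] [u [v [Tu Tv ->]]].
  exists (s * u + a ^+ 2 * (t * v)), (s * v + t * u); split; last by ring.
    by apply: TD; [exact: TM|apply: (TM) => //; exact: TM].
  by apply: TD; exact: TM.
- by move=> x; exists (x ^+ 2), 0; split=> //; rewrite mulr0 addr0.
Qed.

Lemma sub_adjoin T a : is_preorder T -> T `<=` adjoin T a.
Proof. by move=> hT x Tx; exists x, 0; split=> //; [exact: preorder0|ring]. Qed.

Lemma mem_adjoin T a : is_preorder T -> adjoin T a a.
Proof.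
by move=> hT; exists 0, 1; split; [exact: preorder0|exact: preorder1|ring].
Qed.

Lemma maximal_preorder T : is_preorder T -> ~ T (-1) ->
  exists P, [/\ is_preorder P, ~ P (-1), T `<=` P &
    forall a, ~ P a -> adjoin P a (-1)].
Proof.
move=> hT T1.
pose good X := is_preorder (X `|` T) /\ ~ (X `|` T) (-1).
have chain (F : set (set B)) : F `<=` good -> total_on F subset ->
    good (\bigcup_(X in F) X).
  move=> Fgood Ftot.
  have pick2 x y : ((\bigcup_(X in F) X) `|` T) x -> ((\bigcup_(X in F) X) `|` T) y ->
      exists2 X : set B, (F X \/ X = set0) & (X `|` T) x /\ (X `|` T) y.
    move=> [[X FX Xx]|Tx] [[Y FY Yy]|Ty].
    - have [XY|YX] := Ftot _ _ FX FY.
        by exists Y; [left|split; left; [exact: XY|]].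
      by exists X; [left|split; left; [|exact: YX]].
    - by exists X; [left|split; [left|right]].
    - by exists Y; [left|split; [right|left]].
    - by exists set0; [right|split; right].
  have up X x : F X \/ X = set0 -> (X `|` T) x -> ((\bigcup_(X in F) X) `|` T) x.
    by move=> [FX|->] [Xx|Tx]; [left; exists X|right| |right].
  have ok X : F X \/ X = set0 -> is_preorder (X `|` T).
    by case=> [/Fgood[]//|->]; rewrite set0U.
  split.
    split=> [x y|x y|x].
    - move=> hx /(pick2 _ _ hx)[X FX [Xx Xy]]; apply: (up X) => //.
      by have [h _ _] := ok _ FX; exact: h.
    - move=> hx /(pick2 _ _ hx)[X FX [Xx Xy]]; apply: (up X) => //.
      by have [_ h _] := ok _ FX; exact: h.
    - by right; case: hT.
  by case=> [[X FX X1]|//]; have [_] := Fgood _ FX; apply; left.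
have [X [[hX X1] Xmax]] := Zorn_bigcup chain.
exists (X `|` T); split=> // a Xa; apply: contrapT => ha.
have sX := @sub_adjoin (X `|` T) a hX.
apply: (Xmax (adjoin (X `|` T) a)); last first.
  have E : adjoin (X `|` T) a `|` T = adjoin (X `|` T) a.
    by apply/setUidPl => x Tx; apply: sX; right.
  rewrite /good E.
  by split=> //; exact: preorder_adjoin.
rewrite properEneq; split; last by move=> x Xx; apply: sX; left.
apply/eqP => E; apply: Xa; left; rewrite E; exact: mem_adjoin.
Qed.

(** A maximal preordering without -1 works: as neither a nor b can be added to
    it, -1 = s + a t = u + b v, and multiplying such identities puts -1 back
    into P whenever totality or primality fails. *)
Lemma prime_cone_extension T : is_preorder T -> ~ T (-1) ->
  exists2 P, is_prime_cone P & T `<=` P.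
Proof.
move=> hT T1; have [P [hP P1 TP Pmax]] := maximal_preorder hT T1.
exists P => //; have [PD PM PX] := hP; have P0 := preorder0 hP.
have tot a : P a \/ P (- a).
  apply: contrapT => /not_orP[/Pmax[s [t [Ps Pt e1]]] /Pmax[u [v [Pu Pv e2]]]].
  apply: P1.
  (* here -1 = s + a t = u - a v, so that - t is a combination of elements of P,
     and t in the support makes (1 + s)^2 = (a t)^2 vanish modulo the support *)
  have ta : a * t = - (1 + s) by rewrite opprD e1; ring.
  have va : a * v = 1 + u by rewrite -[LHS]opprK -mulNr -[1]opprK e2; ring.
  have Pnt : P (- t).
    have -> : - t = v + s * v + t * u.
      have : v * (a * t) = t * (a * v) by ring.
      by rewrite ta va => /eqP; rewrite -subr_eq0 => /eqP h; apply/eqP;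
        rewrite -subr_eq0; apply/eqP; rewrite -[RHS]h; ring.
    by apply: (PD); [apply: (PD) => //; exact: PM|exact: PM].
  have -> : -1 = a ^+ 2 * (t * (- t)) + (s + s + s ^+ 2).
    have -> : a ^+ 2 * (t * - t) = - (a * t) ^+ 2 by ring.
    by rewrite ta; ring.
  apply: (PD); first by apply: (PM) => //; exact: PM.
  by apply: (PD) => //; exact: PD.
have supp_mul x y : P x -> P (- x) -> P (x * y).
  move=> Px Pnx; have [Py|Pny] := tot y; first exact: PM.
  by rewrite -[x]opprK mulNr -mulrN; exact: PM.
split=> // a b Pab Pnab; apply: contrapT => /not_orP[na nb].
have notP c : ~ (P c /\ P (- c)) -> exists2 c', (c' = c \/ c' = - c) & ~ P c'.
  by move=> nc; have [Pc|nPc] := pselect (P c);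
    [exists (- c) => [|Pnc]; [right|apply: nc]|exists c => //; left].
have [a' ea /Pmax[s [t [Ps Pt e1]]]] := notP _ na.
have [b' eb /Pmax[u [v [Pu Pv e2]]]] := notP _ nb.
have [Pab' Pnab'] : P (a' * b') /\ P (- (a' * b')).
  by case: ea => ->; case: eb => ->; rewrite ?mulrNN ?mulrN ?mulNr ?opprK.
(* (a' t) (b' v) = (1 + s) (1 + u), and a' b' lies in the support *)
apply: P1; have -> : -1 = - (a' * b') * (t * v) + (s + u + s * u).
  have ta : a' * t = - (1 + s) by rewrite opprD e1; ring.
  have ub : b' * v = - (1 + u) by rewrite opprD e2; ring.
  by rewrite mulNr mulrACA ta ub; ring.
apply: (PD); last by apply: (PD); [exact: PD|exact: PM].
by apply: supp_mul; rewrite ?opprK.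
Qed.
End PrimeCones.

(** * Maximal cones of a field *)

Section Precones.
Variable K : fieldType.
Implicit Types (P Q : set K) (x y a b : K).

Definition diff_set P : set K := [set x | exists a b, [/\ P a, P b & x = a - b]].

(** The positive elements of an ordering of the field of differences of P, which
    is not asked to be total. Closure under inverses and totality follow from
    maximality, and leaving them out makes cones easy to build. *)
Record precone P : Prop := Precone {
  precone1 : P 1;
  preconeD : forall x y, P x -> P y -> P (x + y);
  preconeM : forall x y, P x -> P y -> P (x * y);
  precone_sqr : forall x, diff_set P x -> P (x ^+ 2);
  precone_anti : forall x, P x -> P (- x) -> x = 0 }.

Lemma precone0 P : precone P -> P 0.
Proof.
move=> hP; have -> : (0 : K) = 0 ^+ 2 by rewrite expr0n.
by apply: (precone_sqr hP); exists 1, 1; rewrite subrr; split=> //; exact: precone1 hP.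
Qed.

Lemma sub_diff_set P : precone P -> P `<=` diff_set P.
Proof. by move=> hP x Px; exists x, 0; rewrite subr0; split => //; exact: precone0. Qed.

Definition maximal_precone P := precone P /\ forall Q, precone Q -> P `<=` Q -> Q `<=` P.

Lemma maximal_precone_extension P : precone P ->
  exists2 Q, maximal_precone Q & P `<=` Q.
Proof.
move=> hP; pose good X := precone (X `|` P).
have chain (F : set (set K)) : F `<=` good -> total_on F subset ->
    good (\bigcup_(X in F) X).
  move=> Fgood Ftot.
  pose U := (\bigcup_(X in F) X) `|` P.
  pose in_chain X := F X \/ X = set0.
  have pick1 x : U x -> exists2 X, in_chain X & (X `|` P) x.
    by move=> [[X FX Xx]|Px]; [exists X; left|exists set0; right].
  have join2 X Y : in_chain X -> in_chain Y -> exists2 Z, in_chain Z &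
      (X `|` P `<=` Z `|` P /\ Y `|` P `<=` Z `|` P).
    move=> [FX|->] [FY|->].
    - have [XY|YX] := Ftot _ _ FX FY.
        by exists Y; [left|split; try exact: setSU].
      by exists X; [left|split; try exact: setSU].
    - by exists X; [left|split; rewrite ?set0U; try exact: subsetUr].
    - by exists Y; [left|split; rewrite ?set0U; try exact: subsetUr].
    - by exists set0; [right|split].
  have pick2 x y : U x -> U y -> exists2 X, in_chain X & (X `|` P) x /\ (X `|` P) y.
    move=> /pick1[X FX Xx] /pick1[Y FY Yy]; have [Z FZ [XZ YZ]] := join2 _ _ FX FY.
    by exists Z => //; split; [exact: XZ|exact: YZ].
  have up X x : in_chain X -> (X `|` P) x -> U x.
    by move=> [FX|->] [Xx|Px]; [left; exists X|right| |right].
  have ok X : in_chain X -> precone (X `|` P).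
    by case=> [/Fgood//|->]; rewrite set0U.
  split=> [|x y Ux Uy|x y Ux Uy|x [a [b [Ua Ub ->]]]|x Ux Uy].
  - by right; exact: precone1 hP.
  - have [X FX [Xx Xy]] := pick2 _ _ Ux Uy.
    by apply: (up X) => //; exact: preconeD (ok _ FX) _ _ Xx Xy.
  - have [X FX [Xx Xy]] := pick2 _ _ Ux Uy.
    by apply: (up X) => //; exact: preconeM (ok _ FX) _ _ Xx Xy.
  - have [X FX [Xx Xy]] := pick2 _ _ Ua Ub.
    by apply: (up X) => //; apply: precone_sqr (ok _ FX) _ _; exists a, b.
  - have [X FX [Xx Xy]] := pick2 _ _ Ux Uy.
    exact: precone_anti (ok _ FX) _ Xx Xy.
have [X [hX Xmax]] := Zorn_bigcup chain.
exists (X `|` P); last exact: subsetUr.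
split=> // Q hQ XQ; apply: contrapT => nQX; apply: (Xmax Q); last first.
  by rewrite /good; have /setUidPl -> : P `<=` Q by exact: subset_trans XQ.
rewrite properEneq; split; last exact: subset_trans XQ.
by apply/eqP => E; apply: nQX; rewrite E.
Qed.
End Precones.

Section MaximalPrecones.
Variables (K : fieldType) (P : set K).
Hypothesis maxP : maximal_precone P.
Let hP : precone P := maxP.1.
Let P0 : P 0 := precone0 hP.
Let P1 : P 1 := precone1 hP.
Let PD x y : P x -> P y -> P (x + y) := @preconeD _ _ hP x y.
Let PM x y : P x -> P y -> P (x * y) := @preconeM _ _ hP x y.
Let Panti x : P x -> P (- x) -> x = 0 := @precone_anti _ _ hP x.
Let Pmax Q : precone Q -> P `<=` Q -> Q `<=` P := maxP.2 Q.
Let F := diff_set P.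
Let FP x : P x -> F x := @sub_diff_set _ _ hP _.

Lemma diff_setN x : F x -> F (- x).
Proof. by move=> [a [b [Pa Pb ->]]]; exists b, a; rewrite opprB. Qed.

Lemma diff_setD x y : F x -> F y -> F (x + y).
Proof.
move=> [a [b [Pa Pb ->]]] [c [d [Pc Pd ->]]]; exists (a + c), (b + d).
by split; [exact: PD|exact: PD|ring].
Qed.

Lemma diff_setM x y : F x -> F y -> F (x * y).
Proof.
move=> [a [b [Pa Pb ->]]] [c [d [Pc Pd ->]]]; exists (a * c + b * d), (a * d + b * c).
by split; [apply: PD; exact: PM|apply: PD; exact: PM|ring].
Qed.

Lemma addP_eq0 x y : P x -> P y -> x + y = 0 -> x = 0.
Proof.
move=> Px Py /eqP; rewrite addr_eq0 => /eqP xy; apply: Panti => //.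
by rewrite xy opprK.
Qed.

(** The fractions of elements of P again form a cone. *)
Lemma maximal_preconeV x : P x -> P x^-1.
Proof.
have [->|x0 Px] := eqVneq x 0; first by rewrite invr0.
pose Q := [set z | exists a b, [/\ P a, P b, b != 0 & z = a / b]].
have PQ : P `<=` Q by move=> z Pz; exists z, 1; rewrite divr1 oner_eq0.
apply: (Pmax _ PQ); last by exists 1, x; rewrite div1r.
split.
- exact: PQ.
- move=> _ _ [a [b [Pa Pb b0 ->]]] [c [d [Pc Pd d0 ->]]].
  exists (a * d + c * b), (b * d); split; rewrite ?mulf_neq0 ?addf_div//.
    by apply: PD; exact: PM.
  exact: PM.
- move=> _ _ [a [b [Pa Pb b0 ->]]] [c [d [Pc Pd d0 ->]]].
  exists (a * c), (b * d); split; rewrite ?mulf_neq0 ?mulf_div//; exact: PM.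
- move=> _ [_ [_ [[a [b [Pa Pb b0 ->]]] [c [d [Pc Pd d0 ->]]] ->]]].
  exists ((a * d - c * b) ^+ 2), ((b * d) ^+ 2); split.
  + by apply: (precone_sqr hP); exists (a * d), (c * b); split; try exact: PM.
  + by rewrite expr2; apply: (PM); exact: PM.
  + by rewrite expf_neq0// mulf_neq0.
  + by field; rewrite b0 d0.
- move=> _ [a [b [Pa Pb b0 ->]]] [c [d [Pc Pd d0 e]]].
  have : a * d + c * b = 0.
    have -> : a = - (c / d) * b by rewrite -e opprK divfK.
    by field.
  move/(addP_eq0 (PM Pa Pd) (PM Pc Pb)) => /eqP; rewrite mulf_eq0 (negPf d0) orbF.
  by move=> /eqP->; rewrite mul0r.
Qed.

Lemma diff_setV x : F x -> F x^-1.
Proof.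
have [->|x0 Fx] := eqVneq x 0; first by rewrite invr0.
have -> : x^-1 = x * (x ^+ 2)^-1 by field.
by apply: (diff_setM Fx); apply: FP; apply: maximal_preconeV; exact: precone_sqr hP _ Fx.
Qed.

(** If - x is not in P, then P + P x is a cone: two opposite nonzero
    elements of it would express - x as a quotient of elements of P. *)
Lemma diff_set_total x : F x -> P x \/ P (- x).
Proof.
move=> Fx; have [Pnx|nPnx] := pselect (P (- x)); first by right.
left; pose Q := [set z | exists a b, [/\ P a, P b & z = a + b * x]].
have PQ : P `<=` Q by move=> z Pz; exists z, 0; rewrite mul0r addr0.
have QF z : Q z -> F z.
  move=> [a [b [Pa Pb ->]]]; apply: diff_setD; first exact: FP.
  by apply: diff_setM => //; exact: FP.
apply: (Pmax _ PQ); last by exists 0, 1; rewrite mul1r add0r.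
split.
- exact: PQ.
- move=> _ _ [a [b [Pa Pb ->]]] [c [d [Pc Pd ->]]].
  by exists (a + c), (b + d); split; [exact: PD|exact: PD|ring].
- move=> _ _ [a [b [Pa Pb ->]]] [c [d [Pc Pd ->]]].
  exists (a * c + b * d * x ^+ 2), (a * d + b * c); split; last by ring.
    apply: (PD); first exact: PM.
    by apply: (PM); [exact: PM|exact: precone_sqr hP _ Fx].
  by apply: PD; exact: PM.
- move=> _ [y [z [/QF Fy /QF Fz ->]]]; apply/PQ/(precone_sqr hP).
  by apply: diff_setD => //; exact: diff_setN.
- move=> _ [a [b [Pa Pb ->]]] [c [d [Pc Pd e]]].
  have e0 : (a + c) + (b + d) * x = 0 by rewrite mulrDl addrACA -e subrr.
  have [bd0|bd0] := eqVneq (b + d) 0; last first.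
    case: nPnx; have -> : - x = (a + c) / (b + d).
      apply: (canRL (mulfK bd0)); apply/eqP.
      by rewrite -subr_eq0 -[X in _ == X]oppr0 -e0; apply/eqP; ring.
    by apply: (PM); [exact: PD|apply/maximal_preconeV/PD].
  rewrite (addP_eq0 Pb Pd bd0); move: e0; rewrite bd0 mul0r addr0.
  by move/(addP_eq0 Pa Pc) => ->; ring.
Qed.
End MaximalPrecones.

(** Bundling the cone with its maximality lets the type of its field of
    differences carry the field and order structures canonically. *)
Record real_cone (K : fieldType) := RealCone {
  cone_set : set K;
  cone_setP : maximal_precone cone_set }.

Section ConeField.
Variables (K : fieldType) (C : real_cone K).

Definition in_cone_field : {pred K} := fun x => `[< diff_set (cone_set C) x >].

Lemma in_cone_fieldP x : reflect (diff_set (cone_set C) x) (x \in in_cone_field).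
Proof. exact: asboolP. Qed.

Lemma cone_field_divring_closed : divring_closed in_cone_field.
Proof.
have hC := cone_setP C; split.
- by apply/in_cone_fieldP/(sub_diff_set hC.1)/(precone1 hC.1).
- move=> x y /in_cone_fieldP hx /in_cone_fieldP hy; apply/in_cone_fieldP.
  by apply: (diff_setD hC hx); exact: diff_setN.
- move=> x y /in_cone_fieldP hx /in_cone_fieldP hy; apply/in_cone_fieldP.
  by apply: (diff_setM hC hx); exact: diff_setV.
Qed.

HB.instance Definition _ := GRing.isDivringClosed.Build K in_cone_field
  cone_field_divring_closed.

Definition cone_field := {x : K | x \in in_cone_field}.
HB.instance Definition _ := SubChoice.on cone_field.
HB.instance Definition _ := [SubChoice_isSubIntegralDomain of cone_field by <:].
HB.instance Definition _ := [SubIntegralDomain_isSubField of cone_field by <:].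

Definition cf_le (x y : cone_field) : bool := `[< cone_set C (val y - val x) >].
Definition cf_lt (x y : cone_field) : bool := (y != x) && cf_le x y.
Definition cf_norm (x : cone_field) : cone_field := if cf_le 0 x then x else - x.


Let hC := (cone_setP C).1.

Fact cf_le0_add x y : cf_le 0 x -> cf_le 0 y -> cf_le 0 (x + y).
Proof.
move=> /asboolP hx /asboolP hy; apply/asboolP.
by move: (preconeD hC hx hy); rewrite rmorphD rmorph0 !subr0.
Qed.

Fact cf_le0_mul x y : cf_le 0 x -> cf_le 0 y -> cf_le 0 (x * y).
Proof.
move=> /asboolP hx /asboolP hy; apply/asboolP.
by move: (preconeM hC hx hy); rewrite rmorphM rmorph0 !subr0.
Qed.

Fact cf_le0_anti x : cf_le 0 x -> cf_le x 0 -> x = 0.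
Proof.
move=> /asboolP hx /asboolP hy; apply: val_inj; move: hx hy.
rewrite rmorph0 subr0 sub0r; exact: precone_anti.
Qed.

Fact cf_sub_ge0 x y : cf_le 0 (y - x) = cf_le x y.
Proof. by rewrite /cf_le rmorphB rmorph0 subr0. Qed.

Fact cf_le0_total x : cf_le 0 x || cf_le x 0.
Proof.
have /in_cone_fieldP Fx := valP x; apply/orP; rewrite /cf_le rmorph0 subr0 sub0r.
by have [h|h] := diff_set_total (cone_setP C) Fx; [left|right]; apply/asboolP.
Qed.

Fact cf_normN x : cf_norm (- x) = cf_norm x.
Proof.
have le0N : cf_le 0 (- x) = cf_le x 0 by rewrite -[RHS]cf_sub_ge0 sub0r.
rewrite /cf_norm le0N opprK; case: ifP => hx; case: ifP => hy //.
  by rewrite (cf_le0_anti hy hx) oppr0.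
by have := cf_le0_total x; rewrite hx hy.
Qed.

Fact cf_ge0_norm x : cf_le 0 x -> cf_norm x = x.
Proof. by rewrite /cf_norm => ->. Qed.

Fact cf_lt_def x y : cf_lt x y = (y != x) && cf_le x y.
Proof. by []. Qed.

HB.instance Definition _ := Num.IntegralDomain_isLeReal.Build cone_field
  cf_le0_add cf_le0_mul cf_le0_anti cf_sub_ge0 cf_le0_total cf_normN cf_ge0_norm cf_lt_def.

Lemma cf_leE (x y : cone_field) : (x <= y) = `[< cone_set C (val y - val x) >].
Proof. by []. Qed.

Lemma cf_ge0P (x : cone_field) : reflect (cone_set C (val x)) (0 <= x).
Proof. by rewrite cf_leE rmorph0 subr0; exact: asboolP. Qed.

End ConeField.

(** * Real closedness of the field of a maximal cone *)

Section WeightedSquares.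
Variable S : realFieldType.
Implicit Types (M N u p q : {poly S}) (a b c : S).

(** Weights are needed because nonnegative elements of S are not assumed to be
    squares. *)
Inductive wsos : {poly S} -> Prop :=
| wsos0 : wsos 0
| wsosS c u M : 0 <= c -> wsos M -> wsos (c *: u ^+ 2 + M).

Lemma wsosD M N : wsos M -> wsos N -> wsos (M + N).
Proof.
move=> hM hN; elim: hM => [|c u M' c0 _ IH]; first by rewrite add0r.
by rewrite -addrA; exact: wsosS.
Qed.

Lemma wsosZ c u : 0 <= c -> wsos (c *: u ^+ 2).
Proof. by move=> c0; rewrite -[_ *: _]addr0; apply: wsosS => //; exact: wsos0. Qed.

Lemma wsos_sqr u : wsos (u ^+ 2).
Proof. by rewrite -[u ^+ 2]scale1r; apply: wsosZ; rewrite ler01. Qed.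

Lemma wsosM M N : wsos M -> wsos N -> wsos (M * N).
Proof.
move=> hM hN; elim: hM => [|c u M' c0 _ IH]; first by rewrite mul0r; exact: wsos0.
rewrite mulrDl; apply: wsosD IH; elim: hN => [|d v N' d0 _ IH].
  by rewrite mulr0; exact: wsos0.
rewrite mulrDr; apply: wsosD IH.
have -> : c *: u ^+ 2 * (d *: v ^+ 2) = (c * d) *: (u * v) ^+ 2.
  by rewrite -scalerAl -scalerAr scalerA exprMn.
by apply: wsosZ; exact: mulr_ge0.
Qed.

Lemma wsos_ge0 M x : wsos M -> 0 <= M.[x].
Proof.
elim=> [|c u N c0 _ IH]; first by rewrite horner0.
rewrite hornerD hornerZ horner_exp; apply: addr_ge0 => //.
by apply: mulr_ge0 => //; exact: sqr_ge0.
Qed.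

(** Reducing every squared polynomial modulo p; the degree bound is what makes the
    quotient by p smaller than p in cone_field_ivt. *)
Lemma wsos_mod p M : p != 0 -> wsos M -> exists2 N, wsos N &
  p %| M - N /\ (size N <= ((size p).-1 + (size p).-1).-1)%N.
Proof.
move=> p0; elim=> [|c u N c0 _ [N' hN' [dv sz]]].
  by exists 0; [exact: wsos0|rewrite subrr dvdp0 size_poly0].
have usz : (size (u %% p)%R <= (size p).-1)%N by rewrite -ltnS prednK ?size_poly_gt0// ltn_modp.
exists (c *: (u %% p) ^+ 2 + N'); first exact: wsosS; split.
  rewrite opprD addrACA dvdp_add// -scalerBr -mul_polyC dvdp_mull//.
  rewrite subr_sqr dvdp_mulr// [X in X - _](divp_eq u p) addrK; exact: dvdp_mull.
rewrite (leq_trans (size_polyD _ _))// geq_max sz andbT.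
apply: leq_trans (size_scale_leq _ _) _; rewrite expr2.
apply: leq_trans (size_polyMleq _ _) _.
by rewrite -[X in (X <= _)%N]subn1 -[X in (_ <= X)%N]subn1 leq_sub2r// leq_add.
Qed.

Lemma sign_change_mul p q a b : (p * q).[a] * (p * q).[b] < 0 ->
  p.[a] * p.[b] < 0 \/ q.[a] * q.[b] < 0.
Proof.
rewrite !hornerM mulrACA => pq; apply/orP; move: pq; apply: contraTT.
by rewrite negb_or -!leNgt => /andP[]; exact: mulr_ge0.
Qed.

Lemma XsubC_sign_change c a b : a <= b ->
  ('X - c%:P).[a] * ('X - c%:P).[b] < 0 -> a <= c <= b.
Proof.
move=> ab; apply: contraTT; rewrite negb_and -!ltNge -leNgt !hornerXsubC => /orP[ca|bc].
  by rewrite mulr_ge0 ?subr_ge0 ?(ltW ca) ?(le_trans (ltW ca)).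
by rewrite mulr_le0 ?subr_le0 ?(ltW bc) ?(le_trans _ (ltW bc)).
Qed.

Lemma sign_change_real_closed :
  (forall a b p, a <= b -> p.[a] * p.[b] < 0 -> exists2 x, a <= x <= b & root p x) ->
  Num.real_closed_axiom S.
Proof.
move=> ivt p a b ab /andP[pa pb].
have [pa0|pa0] := eqVneq p.[a] 0; first by exists a; rewrite ?lexx ?ab//; apply/rootP.
have [pb0|pb0] := eqVneq p.[b] 0; first by exists b; rewrite ?lexx ?ab//; apply/rootP.
apply: ivt => //; rewrite nmulr_rlt0; first by rewrite lt_def pb0.
by rewrite lt_neqAle pa0.
Qed.
End WeightedSquares.

Section RealClosed.
Variables (K : closedFieldType) (C : real_cone K).
Notation S := (cone_field C).
Implicit Types (p : {poly S}) (a b : S).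
Let maxC : maximal_precone (cone_set C) := cone_setP C.

(** Induction on the degree. A factorization of p leaves the sign change to one of
    the factors, and so does a root in the field that lies outside the interval.
    If p is irreducible with a root beta outside the field, then the values at
    beta of the weighted sums of squares form a cone that contains the given one
    and of which beta is a difference, against maximality. *)
Lemma cone_field_ivt a b p : a <= b -> p.[a] * p.[b] < 0 ->
  exists2 x, a <= x <= b & root p x.
Proof.
move=> ab; have [n] := ubnP (size p); elim: n p => // n IHn p; rewrite ltnS => pn pab.
have p0 : p != 0 by apply: contraTneq pab => ->; rewrite !horner0 mul0r ltxx.
have p1 : size p != 1%N.
  apply: contraTneq pab => /eqP/size_poly1P[c _ ->]; rewrite !hornerC -leNgt.
  by rewrite -expr2 sqr_ge0.
have split_p g : g %| p -> (1 < size g)%N -> (size g < size p)%N ->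
    exists2 x, a <= x <= b & root p x.
  move=> /divpK pE g1 gp; set h := p %/ g in pE.
  have h0 : h != 0 by apply: contraNneq p0 => h0; rewrite -pE h0 mul0r.
  have g0 : g != 0 by rewrite -size_poly_gt0 (ltn_trans _ g1).
  have hp : (size h < size p)%N.
    by rewrite -pE size_mul// -ltnS prednK ?addn_gt0 ?size_poly_gt0 ?h0// -addn1 ltn_add2l.
  have /sign_change_mul[hab|gab] : (h * g).[a] * (h * g).[b] < 0 by rewrite pE.
    have [x abx hx] := IHn h (leq_trans hp pn) hab.
    by exists x => //; rewrite -pE rootM hx.
  have [x abx gx] := IHn g (leq_trans gp pn) gab.
  by exists x => //; rewrite -pE rootM gx orbT.
have [beta pbeta] : exists x, root (map_poly val p) x.
  by apply/closed_rootP; rewrite size_map_poly.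
have [/[dup] betaF /in_cone_fieldP Fb|nFb] := boolP (beta \in in_cone_field C).
  pose s : S := Sub beta betaF.
  have ps : root p s.
    by move: pbeta; have -> : beta = val s by []; rewrite fmorph_root.
  have /factor_theorem[q pE] := ps.
  have pab' : (q * ('X - s%:P)).[a] * (q * ('X - s%:P)).[b] < 0 by rewrite -pE.
  have [qab|/(XsubC_sign_change ab) abs] := sign_change_mul pab'; last by exists s.
  have q0 : q != 0 by apply: contraNneq p0 => q0; rewrite pE q0 mul0r.
  have qn : (size q < n)%N.
    by apply: leq_trans pn; rewrite pE size_mul ?polyXsubC_eq0// size_XsubC addn2.
  by have [x abx qx] := IHn q qn qab; exists x => //; rewrite pE rootM qx.
have [[g [gp g1 gszp]]|/forallNP irr] := pselect (exists g, [/\ g %| p, (1 < size g)%N & (size g < size p)%N]).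
  exact: split_p gp g1 gszp.
exfalso.
pose ev M := (map_poly (val : S -> K) M).[beta].
have evD M N : ev (M + N) = ev M + ev N by rewrite /ev rmorphD hornerD.
have evM M N : ev (M * N) = ev M * ev N by rewrite /ev rmorphM hornerM.
have evN M : ev (- M) = - ev M by rewrite /ev rmorphN hornerN.
have ev1 : ev 1 = 1 by rewrite /ev rmorph1 hornerE.
have evp : ev p = 0 by apply/eqP.
(* evaluation at beta identifies the polynomials modulo p with a field *)
have irrp M : coprimep M p || (p %| M).
  have d1 : (0 < size (gcdp M p))%N by rewrite size_poly_gt0 gcdp_eq0 negb_and p0 orbT.
  have [g1|gp] := ltnP 1 (size (gcdp M p)); last by rewrite /coprimep eqn_leq gp d1.
  have := irr (gcdp M p); rewrite dvdp_gcdr g1.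
  have [gp|pg _] := ltnP (size (gcdp M p)) (size p); first by case.
  have /eqp_dvdl <- : gcdp M p %= p.
    by rewrite -dvdp_size_eqp ?dvdp_gcdr// eqn_leq pg dvdp_leq ?dvdp_gcdr.
  by rewrite dvdp_gcdl orbT.
have bezout M : coprimep M p -> exists u, ev u * ev M = 1.
  move=> /Bezout_eq1_coprimepP[[u v] /= e]; exists u.
  by rewrite -evM -ev1 -e evD !evM evp mulr0 addr0.
have coprime_p M : ev M != 0 -> exists u, ev u * ev M = 1.
  have /orP[/bezout//|/dvdpP[q ->]] := irrp M.
  by rewrite evM evp mulr0 eqxx.
have dvd_ev M : ev M = 0 -> p %| M.
  have /orP[/bezout[u]|//] := irrp M.
  by move=> /[swap] ->; rewrite mulr0 => /eqP; rewrite eq_sym oner_eq0.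
have ev_val c : ev c%:P = val c by rewrite /ev map_polyC hornerC.
pose Q : set K := [set z | exists2 M, wsos M & z = ev M].
have PQ : cone_set C `<=` Q.
  move=> z Cz; have zF : z \in in_cone_field C.
    by apply/in_cone_fieldP; exact: sub_diff_set maxC.1 _ Cz.
  exists ((Sub z zF : S)%:P); last by rewrite ev_val.
  rewrite -alg_polyC -(expr1n _ 2); apply: wsosZ.
  exact/cf_ge0P.
(* If M is -1 at beta, then 1 + N = h p with N the reduction of M. As 1 + N is
   positive everywhere, h changes sign where p does, and h has smaller degree,
   so h has a root, where 1 + N would vanish. *)
have no_minus1 M : wsos M -> ev M != -1.
  move=> hM; apply/eqP => M1; have [N hN [dv sz]] := wsos_mod p0 hM.
  have N1 : ev (1 + N) = 0.
    have dv0 : ev (M - N) = 0 by move/dvdpP: dv => [q ->]; rewrite evM evp mulr0.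
    rewrite evD ev1; have <- : ev M = ev N by rewrite -[in LHS](subrK N M) evD dv0 add0r.
    by rewrite M1 subrr.
  have /divpK hE := dvd_ev _ N1; set h := _ %/ _ in hE.
  have N_gt0 (x : S) : 0 < (1 + N).[x] by rewrite hornerD hornerE ltr_wpDr ?wsos_ge0.
  have h0 : h != 0.
    by apply: contraTneq (N_gt0 a) => h0; rewrite -hE h0 mul0r horner0 ltxx.
  have hn : (size h < size p)%N.
    have : (size (h * p)%R <= maxn 1 ((size p).-1 + (size p).-1).-1)%N.
      rewrite hE (leq_trans (size_polyD _ _))// size_poly1 geq_max leq_maxl /=.
      by rewrite (leq_trans sz)// leq_maxr.
    rewrite size_mul//; move: p0 p1; rewrite -size_poly_gt0 /maxn.
    move: (size h) (size p) => s t; case: ifP => *; lia.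
  have hab : h.[a] * h.[b] < 0.
    have := mulr_gt0 (N_gt0 a) (N_gt0 b); rewrite -hE !hornerM mulrACA.
    by rewrite nmulr_lgt0.
  have [x _ hx] := IHn h (leq_trans hn pn) hab.
  by have := N_gt0 x; rewrite -hE hornerM (rootP hx) mul0r ltxx.
(* for antisymmetry: if M and N are opposite nonzero values at beta and u inverts
   M there, then u^2 M N takes the value -1 *)
have hQ : precone Q.
  have QF z : diff_set Q z -> exists M, z = ev M.
    by move=> [_ [_ [[M _ ->] [N _ ->] ->]]]; exists (M - N); rewrite evD evN.
  split.
  - by apply: PQ; exact: precone1 maxC.1.
  - by move=> _ _ [M hM ->] [N hN ->]; exists (M + N); rewrite ?evD//; exact: wsosD.
  - by move=> _ _ [M hM ->] [N hN ->]; exists (M * N); rewrite ?evM//; exact: wsosM.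
  - by move=> _ /QF[M ->]; exists (M ^+ 2); [exact: wsos_sqr|rewrite !expr2 evM].
  - move=> _ [M hM ->] [N hN eN]; apply/eqP; apply: contraT => /coprime_p[u eu].
    have /eqP[] := no_minus1 (u ^+ 2 * (M * N)) (wsosM (wsos_sqr u) (wsosM hM hN)).
    rewrite expr2 !evM -eN; transitivity (- (ev u * ev M) ^+ 2); first by ring.
    by rewrite eu expr1n.
have QP := maxC.2 _ hQ PQ.
(* 4 beta = (beta + 1)^2 - (beta - 1)^2 *)
have evX : ev 'X = beta by rewrite /ev map_polyX hornerX.
have ev4 : ev (4^-1)%:P * 4 = 1 :> K.
  have <- : ev 4%:P = 4 by rewrite ev_val; exact: rmorph_nat.
  by rewrite -evM -polyCM mulVf ?ev1// pnatr_eq0.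
have q4 : 0 <= (4^-1 : S) by rewrite invr_ge0 ler0n.
move/negP: nFb; apply; apply/in_cone_fieldP.
exists (ev (4^-1 *: ('X + 1) ^+ 2)), (ev (4^-1 *: ('X - 1) ^+ 2)); split.
- by apply: QP; exists (4^-1 *: ('X + 1) ^+ 2) => //; exact: wsosZ.
- by apply: QP; exists (4^-1 *: ('X - 1) ^+ 2) => //; exact: wsosZ.
have ev_wsqr c u : ev (c *: u ^+ 2) = ev c%:P * (ev u * ev u).
  by rewrite -mul_polyC evM [ev (u ^+ 2)]evM.
have e1 : ev ('X + 1) = beta + 1 by rewrite evD ev1 evX.
have e2 : ev ('X - 1) = beta - 1 by rewrite evD evN ev1 evX.
rewrite (ev_wsqr _ ('X + 1)) (ev_wsqr _ ('X - 1)) e1 e2.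
transitivity (ev (4^-1)%:P * 4 * beta); first by rewrite ev4 mul1r.
ring.
Qed.

Fact cone_field_real_closed : Num.real_closed_axiom S.
Proof. exact: sign_change_real_closed cone_field_ivt. Qed.

HB.instance Definition _ := Num.RealField_isClosed.Build S cone_field_real_closed.
End RealClosed.

(** * Generic points of prime ideals *)

(** Throughout, I is a prime ideal of A[X] that meets A in the kernel of psi; a
    generic zero of I is a point t with I the kernel of evaluation at t. *)
Section GenericStep.
Variables (A : comNzRingType) (K : closedFieldType) (psi : {rmorphism A -> K}).
Variable I : set {poly A}.
Implicit Types (p q r : {poly A}).
Notation "p ^psi" := (map_poly psi p) (at level 2, format "p ^psi").
Hypothesis ID : forall p q, I p -> I q -> I (p + q).
Hypothesis IM : forall p q, I q -> I (p * q).
Hypothesis Iprime : forall p q, I (p * q) -> I p \/ I q.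
Hypothesis IC : forall c, I c%:P <-> psi c = 0.

Let IN p : I p -> I (- p).
Proof. by move=> Ip; rewrite -mulN1r; exact: IM. Qed.

Let IB p q : I p -> I q -> I (p - q).
Proof. by move=> Ip /IN; exact: ID. Qed.

Let I_ker p : p^psi = 0 -> I p.
Proof.
move=> p0; rewrite -[p]coefK poly_def; apply: big_ind => //.
  by rewrite -polyC0 IC rmorph0.
move=> i _; rewrite -mul_polyC mulrC; apply/IM/IC.
by rewrite -coef_map p0 coef0.
Qed.

(** Removes the leading coefficients killed by psi, so that pseudo-division by the
    result has a leading coefficient that is invertible after psi. *)
Definition trunc p := \poly_(i < size p^psi) p`_i.

Let trunc_psi p : (trunc p)^psi = p^psi.
Proof.
apply/polyP => i; rewrite coef_map coef_poly; case: ltnP => [_|h].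
  by rewrite coef_map.
by rewrite raddf0 nth_default.
Qed.

Let size_trunc p : size (trunc p) = size p^psi.
Proof.
apply/eqP; rewrite eqn_leq size_poly /=.
have : (size (trunc p)^psi <= size (trunc p))%N by exact: size_poly.
by rewrite trunc_psi.
Qed.

Let I_trunc p : I (trunc p) -> I p.
Proof.
move=> h; rewrite -[p](subrK (trunc p)); apply: ID => //; apply: I_ker.
by rewrite rmorphB /= trunc_psi subrr.
Qed.

Let trunc_I p : I p -> I (trunc p).
Proof.
move=> h; rewrite -[trunc p](subrK p); apply: ID => //; apply: I_ker.
by rewrite rmorphB /= trunc_psi subrr.
Qed.

Let lead_trunc p : p^psi != 0 -> size p = size p^psi -> psi (lead_coef p) != 0.
Proof.
by move=> p0 sp; rewrite lead_coefE sp -coef_map -lead_coefE lead_coef_eq0.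
Qed.

Let Iexp c k q : psi c != 0 -> I (c ^+ k *: q) -> I q.
Proof.
move=> c0; rewrite -mul_polyC => /Iprime[/IC|//].
by rewrite rmorphXn => /eqP; rewrite expf_eq0 (negPf c0) andbF.
Qed.

(** After psi, an element of I of least degree is irreducible up to its
    coefficients; any root of it is generic. *)
Lemma generic_root p : I p -> p^psi != 0 ->
  exists t, forall q, I q <-> q^psi.[t] = 0.
Proof.
move=> Ip p0.
have [{Ip p0}p [Ip p0 sp] pmin] : exists2 p, [/\ I p, p^psi != 0 & size p = size p^psi] &
    forall q, I q -> (size q^psi < size p^psi)%N -> q^psi = 0.
  have [n] := ubnP (size p^psi); elim: n p Ip p0 => // n IHn p Ip p0; rewrite ltnS => pn.
  have [[q [Iq q0 qp]]|/forallNP h] := pselect (exists q, [/\ I q, q^psi != 0 & (size q^psi < size p^psi)%N]).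
    exact: IHn Iq q0 (leq_trans qp pn).
  exists (trunc p); first by rewrite trunc_psi size_trunc; split=> //; exact: trunc_I.
  move=> q Iq; rewrite trunc_psi => qp; apply/eqP/negPn/negP => q0.
  by apply: (h q).
have lp := lead_trunc p0 sp.
have pn0 : p != 0 by rewrite -size_poly_eq0 sp size_poly_eq0.
have sp1 : size p^psi != 1%N.
  apply/negP => /eqP s1; have := p0; rewrite [p^psi]size1_polyC ?s1//.
  rewrite polyC_eq0 coef_map => /eqP; apply; apply/IC.
  by rewrite -size1_polyC ?sp ?s1.
have [t pt] : exists t, root p^psi t by apply/closed_rootP.
have evM q r : (q * r)^psi.[t] = q^psi.[t] * r^psi.[t] by rewrite rmorphM hornerM.
have evD q r : (q + r)^psi.[t] = q^psi.[t] + r^psi.[t] by rewrite rmorphD hornerD.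
have evZ c q : (c *: q)^psi.[t] = psi c * q^psi.[t] by rewrite map_polyZ hornerZ.
have evp : p^psi.[t] = 0 by apply/eqP.
exists t => q; split.
  move=> Iq; have [k u r /= e /(_ pn0) rp] := Pdiv.ComRing.redivpP q p.
  have Ir : I r.
    have -> : r = lead_coef p ^+ k *: q - u * p by rewrite e addrC addKr.
    by apply: IB; [rewrite -mul_polyC|]; exact: IM.
  have r0 : r^psi = 0.
    by apply: pmin => //; rewrite -sp; apply: leq_ltn_trans rp; exact: size_poly.
  have /eqP : psi (lead_coef p ^+ k) * q^psi.[t] = 0.
    by rewrite -evZ e evD evM evp mulr0 r0 horner0 addr0.
  by rewrite rmorphXn mulf_eq0 expf_eq0 (negPf lp) andbF /= => /eqP.
(* A polynomial q vanishing at t but not in I, of least degree, can be divided by p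
   or divide p; the remainder is in I by minimality, and primality contradicts
   either psi (lead_coef p) != 0 or the minimality of p. *)
have [n] := ubnP (size q); elim: n q => // n IHn q; rewrite ltnS => qn qt.
apply: contrapT => nIq.
have sq : size q = size q^psi.
  apply/eqP; rewrite eqn_leq size_poly andbT leqNgt; apply/negP => lt.
  apply: nIq; apply: I_trunc; apply: IHn; last by rewrite trunc_psi.
  by rewrite size_trunc (leq_trans lt).
have q0 : q^psi != 0 by apply/negP => /eqP /I_ker.
have lq := lead_trunc q0 sq.
have qn0 : q != 0 by rewrite -size_poly_eq0 sq size_poly_eq0.
have sq1 : (1 < size q)%N.
  rewrite ltnNge; apply/negP => s1; apply: nIq; move: qt.
  by rewrite [q]size1_polyC// map_polyC hornerC => ?; apply/IC.
have [le_pq|lt_qp] := leqP (size p) (size q).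
  have [k u r /= e /(_ pn0) rp] := Pdiv.ComRing.redivpP q p.
  have Ir : I r.
    apply: IHn; first by rewrite (leq_trans rp)// (leq_trans le_pq).
    have -> : r = lead_coef p ^+ k *: q - u * p by rewrite e addrC addKr.
    by rewrite -mulN1r !(evD, evM, evZ) evp qt !mulr0 addr0.
  by apply/nIq/(Iexp lp (k := k)); rewrite e; apply: ID => //; exact: IM.
have [k u r /= e /(_ qn0) rq] := Pdiv.ComRing.redivpP p q.
have eu : u * q = lead_coef q ^+ k *: p - r by rewrite e addrK.
have Ir : I r.
  apply: IHn; first by rewrite (leq_trans rq).
  have -> : r = lead_coef q ^+ k *: p - u * q by rewrite e addrC addKr.
  by rewrite -mulN1r !(evD, evM, evZ) evp qt !mulr0 addr0.
have Iu : I u.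
  have : I (u * q) by rewrite eu -mul_polyC; apply: IB => //; exact: IM.
  by case/Iprime.
have uq : size (u^psi * q^psi) = size p^psi.
  rewrite -rmorphM eu rmorphB /= map_polyZ size_polyDl ?size_polyN size_scale ?rmorphXn ?expf_neq0//.
  rewrite -sp (leq_ltn_trans _ lt_qp)// (leq_trans _ (ltnW rq))//; exact: size_poly.
have u0 : u^psi != 0.
  by apply: contraNneq p0 => u0; rewrite -size_poly_eq0 -uq u0 mul0r size_poly0.
suff : (size u^psi < size p^psi)%N by move/(pmin _ Iu) => /eqP; rewrite (negPf u0).
rewrite -uq size_mul//; move: sq1; rewrite sq; move: (size u^psi) (size q^psi) => i [|[|j]] // _.
by rewrite !addnS /= ltnS leq_addr.
Qed.

Lemma generic_transcendental t :
  (forall p, I p -> p^psi = 0) -> (forall p, p^psi != 0 -> ~~ root p^psi t) ->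
  forall q, I q <-> q^psi.[t] = 0.
Proof.
move=> h1 h2 q; split; first by move/h1 => ->; rewrite horner0.
move=> qt; apply: contrapT => nIq.
have /h2/negP[] : q^psi != 0 by apply/eqP => /I_ker.
exact/rootP.
Qed.
End GenericStep.

(** The real numbers are uncountable. *)
Lemma avoid_roots (R : realType) (F : nat -> {poly R[i]}) :
  exists t, forall n, F n != 0 -> ~~ root (F n) t.
Proof.
apply: contrapT => /forallNP h.
pose B n : set R := [set x | F n != 0 /\ root (F n) (real_complex R x)].
have cB : countable (\bigcup_n B n).
  apply: bigcup_countable => // n _; apply: finite_set_countable.
  have [F0|F0] := eqVneq (F n) 0.
    by rewrite (_ : B n = set0) // -subset0 => x []; rewrite F0 eqxx.
  pose rs := sval (closed_field_poly_normal (F n)).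
  apply: (@sub_finite_set _ _ [set` [seq complex.Re z | z <- rs]]).
    move=> x [_ rx] /=; apply/mapP; exists (real_complex R x) => //.
    move: rx; rewrite /rs; case: closed_field_poly_normal => s /= e.
    by rewrite {1}e rootZ ?lead_coef_eq0// root_prod_XsubC.
  exact: finite_seq.
have := countable_lebesgue_measure0 cB.
have -> : \bigcup_n B n = [set` (`]-oo, +oo[%R : interval R)].
  apply/seteqP; split=> x _; first by rewrite /= in_itv.
  have /existsNP[n /not_implyP[n0 /negP]] := h (real_complex R x).
  by rewrite negbK => rx; exists n.
by rewrite lebesgue_measure_itv.
Qed.

(** Either the zero ideal after psi, where a transcendental point is generic and
    exists because A is countable, or generic_root. *)
Lemma generic_extension (R : realType) (A : countComNzRingType) (psi : {rmorphism A -> R[i]})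
  (I : set {poly A}) :
  (forall p q, I p -> I q -> I (p + q)) -> (forall p q, I q -> I (p * q)) ->
  (forall p q, I (p * q) -> I p \/ I q) -> (forall c, I c%:P <-> psi c = 0) ->
  exists t, forall q, I q <-> (map_poly psi q).[t] = 0.
Proof.
move=> ID IM Iprime IC.
have [[p [Ip p0]]|/forallNP h] := pselect (exists p, I p /\ map_poly psi p != 0).
  exact: generic_root ID IM Iprime IC p Ip p0.
pose F n : {poly R[i]} := if unpickle n is Some p then map_poly psi (p : {poly A}) else 0.
have [t ht] := avoid_roots F; exists t; apply: generic_transcendental => //.
  by move=> p Ip; apply/eqP/negPn/negP => p0; apply: (h p).
by move=> p p0; have := ht (pickle p); rewrite /F pickleK; apply.
Qed.

(** * Elimination of one variable *)

Section PosCount.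
Variable K : rcfType.
Implicit Types (p e : {poly K}) (sq : seq {poly K}) (z : seq K).

(** A combination of Tarski queries that counts the entries of z at which all
    polynomials of sq are positive: s ^ 2 + s is nonzero only for the sign s = 1. *)
Fixpoint poscount z sq e : int :=
  if sq is q :: sq' then poscount z sq' (q ^+ 2 * e) + poscount z sq' (q * e)
  else taq z e.

Lemma poscountE z sq e : poscount z sq e =
  \sum_(x <- z) sgz e.[x] * \prod_(q <- sq) (sgz q.[x] ^+ 2 + sgz q.[x]).
Proof.
elim: sq e => [|q sq IH] e /=.
  by apply: eq_bigr => x _; rewrite big_nil mulr1.
rewrite !IH -big_split /=; apply: eq_bigr => x _.
by rewrite big_cons !hornerE !sgzM /=; ring.
Qed.

Lemma poscount_gt0P p sq : p != 0 ->
  reflect (exists2 x, root p x & {in sq, forall q, 0 < q.[x]})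
    (0 < poscount (rootsR p) sq 1).
Proof.
move=> p0; rewrite poscountE.
have ge0 x : 0 <= sgz (1 : {poly K}).[x] * \prod_(q <- sq) (sgz q.[x] ^+ 2 + sgz q.[x]).
  rewrite hornerE sgz1 mul1r big_seq; apply: prodr_ge0 => q _.
  by case: sgzP.
have rE x : (x \in rootsR p) = root p x.
  by have := roots_on_rootsR p0 x; rewrite in_itv /= => <-.
apply: (iffP idP) => [|[x px hx]].
  rewrite lt0r psumr_eq0 // => /andP[/allPn[x xp]]; rewrite /= hornerE sgz1 mul1r.
  rewrite prodf_seq_neq0 => /allP h _; exists x; first by rewrite -rE.
  by move=> q /h /=; case: sgzP.
rewrite lt0r sumr_ge0 // andbT psumr_eq0 //; apply/allPn; exists x; first by rewrite rE.
rewrite /= hornerE sgz1 mul1r prodf_seq_neq0; apply/allP => q /hx /=.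
by case: sgzP.
Qed.

End PosCount.

Section Near.
Variables (A : comNzRingType) (s0 : A -> int).

(** A property of morphisms from A to real closed fields holds near s0 if it follows
    from finitely many of the sign conditions sgz (psi a) = s0 a. For s0 the signs
    of a morphism phi, this morphism itself is near s0, so statements that hold
    near s0 compare phi with the other morphisms. *)
Definition near_signs (P : forall K : rcfType, {rmorphism A -> K} -> Prop) :=
  exists L : seq A, forall (K : rcfType) (psi : {rmorphism A -> K}),
    {in L, forall a, sgz (psi a) = s0 a} -> P K psi.

Lemma near_all P : (forall K psi, P K psi) -> near_signs P.
Proof. by move=> h; exists [::]. Qed.

Lemma near_mono P Q : (forall K psi, P K psi -> Q K psi) ->
  near_signs P -> near_signs Q.
Proof. by move=> PQ [L hL]; exists L => K psi /hL; exact: PQ. Qed.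

Lemma near_and P Q : near_signs P -> near_signs Q ->
  near_signs (fun K psi => P K psi /\ Q K psi).
Proof.
move=> [L hL] [M hM]; exists (L ++ M) => K psi h; split.
  by apply: hL => a aL; apply: h; rewrite mem_cat aL.
by apply: hM => a aM; apply: h; rewrite mem_cat aM orbT.
Qed.

Lemma near_sign a : near_signs (fun K psi => sgz (psi a) = s0 a).
Proof. by exists [:: a] => K psi; apply; rewrite mem_head. Qed.

Lemma near_seq (T : eqType) (l : seq T) (P : T -> forall K : rcfType, {rmorphism A -> K} -> Prop) :
  {in l, forall t, near_signs (P t)} ->
  near_signs (fun K psi => {in l, forall t, P t K psi}).
Proof.
elim: l => [|t l IHl] h; first exact: near_all.
have hl : {in l, forall u, near_signs (P u)} by move=> u ul; apply: h; rewrite inE ul orbT.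
have := near_and (h t (mem_head _ _)) (IHl hl).
by apply: near_mono => K psi [Pt Pl] u; rewrite inE => /predU1P[->|/Pl].
Qed.

Implicit Types (p q : {poly A}).

(** The size common to all images of p under morphisms near s0. *)
Definition nsize p := \max_(i < size p | s0 p`_i != 0) i.+1.

Lemma near_size p : near_signs (fun K psi => size (map_poly psi p) = nsize p).
Proof.
have h : {in p : seq A, forall a, near_signs (fun K psi => sgz (psi a) = s0 a)}.
  by move=> a _; exact: near_sign.
apply: near_mono (near_seq h) => K psi {}h.
have nz i : (i < size p)%N -> ((map_poly psi p)`_i != 0) = (s0 p`_i != 0).
  by move=> ip; rewrite coef_map /= -h ?mem_nth// sgz_eq0.
apply/eqP; rewrite eqn_leq; apply/andP; split.
  have [->|pn0] := eqVneq (map_poly psi p) 0; first by rewrite size_poly0.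
  have ip : ((size (map_poly psi p)).-1 < size p)%N.
    by rewrite prednK ?size_poly_gt0// size_poly.
  rewrite -[X in (X <= _)%N](@prednK (size _)) ?size_poly_gt0//.
  apply: (@leq_bigmax_cond _ _ (fun i : 'I_(size p) => i.+1) (Ordinal ip)).
  by rewrite /= -nz// -lead_coefE lead_coef_eq0.
apply/bigmax_leqP => i /=; rewrite -nz//; apply: contraNT.
by rewrite -leqNgt => /(nth_default 0) ->.
Qed.

Definition nlead p := p`_(nsize p).-1.

Lemma near_lead p : near_signs (fun K psi => lead_coef (map_poly psi p) = psi (nlead p)).
Proof. by apply: near_mono (near_size p) => K psi h; rewrite lead_coefE h coef_map. Qed.

Import Pdiv.Ring Pdiv.CommonRing.

(** Pseudo-division only uses ring operations on coefficients and comparisons of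
    sizes, and near s0 the sizes are constant: the same computation in A[X]
    describes all of them. *)
Lemma near_redivp_rec q n k qq r : exists k' qq' r',
  near_signs (fun K psi =>
    redivp_rec (map_poly psi q) k (map_poly psi qq) (map_poly psi r) n =
    (k', map_poly psi qq', map_poly psi r')).
Proof.
have base m := near_and (near_and (near_size q) (near_size m)) (near_and (near_lead q) (near_lead m)).
pose q1 (qq r : {poly A}) : {poly A} := qq * (nlead q)%:P + nlead r *: 'X^(nsize r - nsize q).
pose r1 (r : {poly A}) : {poly A} := r * (nlead q)%:P - nlead r *: 'X^(nsize r - nsize q) * q.
have q1E (K : rcfType) (psi : {rmorphism A -> K}) (qq1 m : {poly A}) : map_poly psi (q1 qq1 m) = map_poly psi qq1 * (psi (nlead q))%:P
  + psi (nlead m) *: 'X^(nsize m - nsize q).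
  by rewrite /q1 rmorphD rmorphM /= map_polyC map_polyZ map_polyXn.
have r1E (K : rcfType) (psi : {rmorphism A -> K}) (r2 : {poly A}) : map_poly psi (r1 r2) = map_poly psi r2 * (psi (nlead q))%:P
  - psi (nlead r2) *: 'X^(nsize r2 - nsize q) * map_poly psi q.
  by rewrite /r1 rmorphB !rmorphM /= map_polyC map_polyZ map_polyXn.
elim: n k qq r => [|n IHn] k qq r; case: (ltnP (nsize r) (nsize q)) => h.
- exists k, qq, r; apply: near_mono (base r) => K psi [[sq sr] [lq lr]].
  by rewrite /= sq sr h.
- exists k.+1, (q1 qq r), (r1 r); apply: near_mono (base r) => K psi [[sq sr] [lq lr]].
  by rewrite /= sq sr ltnNge h /= lq lr -q1E -r1E.
- exists k, qq, r; apply: near_mono (base r) => K psi [[sq sr] [lq lr]].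
  by rewrite /= sq sr h.
have [k' [qq' [r' IH]]] := IHn k.+1 (q1 qq r) (r1 r).
exists k', qq', r'; apply: near_mono (near_and IH (base r)) => K psi [IH' [[sq sr] [lq lr]]].
by rewrite -IH' /= sq sr ltnNge h /= lq lr -q1E -r1E.
Qed.

Lemma near_redivp p q : exists k r, near_signs (fun K psi =>
   rscalp (map_poly psi p) (map_poly psi q) = k /\
   rmodp (map_poly psi p) (map_poly psi q) = map_poly psi r).
Proof.
have [k [qq [r h]]] := near_redivp_rec q (nsize p) 0 0 p.
have hs := near_and (near_size p) (near_size q).
case: (posnP (nsize q)) => q0.
  exists 0%N, p; apply: near_mono (near_and h hs) => K psi [{}h [sp sq]].
  rewrite /rscalp /rmodp unlock -size_poly_eq0 sq q0 eqxx //.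
exists k, r; apply: near_mono (near_and h hs) => K psi [{}h [sp sq]].
by rewrite /rscalp /rmodp unlock -size_poly_eq0 sq eqn0Ngt q0 /= sp -[X in redivp_rec _ _ X](rmorph0 (map_poly psi)) h.
Qed.

Lemma near_next_mod p q : exists r, near_signs (fun K psi =>
   next_mod (map_poly psi p) (map_poly psi q) = map_poly psi r).
Proof.
have [k [r h]] := near_redivp p q.
exists (- (nlead q) ^+ k *: r).
apply: near_mono (near_and h (near_lead q)) => K psi [[hk hr] lq].
by rewrite /next_mod lq hk hr map_polyZ rmorphN rmorphXn.
Qed.

(** Signed remainder sequences near s0 are the images of one sequence over A. *)
Lemma near_mods p q : exists l : seq {poly A}, near_signs (fun K psi =>
   mods (map_poly psi p) (map_poly psi q) = map (map_poly psi) l).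
Proof.
have [n] := ubnP (nsize q); elim: n p q => // n IHn p q; rewrite ltnS => qn.
have [r hr] := near_next_mod p q.
have base := near_and (near_and (near_size p) (near_size q)) (near_and hr (near_size r)).
have [p0|p0] := posnP (nsize p).
  exists [::]; apply: near_mono base => K psi [[sp _] _].
  by rewrite mods_rec -size_poly_eq0 sp p0.
have [q0|q0] := posnP (nsize q).
  exists [:: p]; apply: near_mono base => K psi [[sp sq] _].
  by rewrite mods_rec -size_poly_eq0 sp eqn0Ngt p0 mods_rec -size_poly_eq0 sq q0.
have [ltrq|lerq] := ltnP (nsize r) (nsize q).
  have [l hl] := IHn q r (leq_trans ltrq qn).
  exists (p :: l); apply: near_mono (near_and base hl) => K psi [[[sp sq] [hr' sr]] {}hl].
  by rewrite mods_rec -size_poly_eq0 sp eqn0Ngt p0 hr' hl.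
(* the remainder is smaller than the divisor, so no such morphism is near *)
exists [::]; apply: near_mono base => K psi [[sp sq] [hr' sr]].
suff : (size (next_mod (map_poly psi p) (map_poly psi q)) < nsize q)%N.
  by rewrite hr' sr ltnNge lerq.
rewrite /next_mod -sq; apply: leq_ltn_trans (size_scale_leq _ _) _.
by rewrite ltn_rmodp -size_poly_eq0 sq -lt0n.
Qed.
Lemma near_head_mul (l : seq A) a : exists b : bool, near_signs (fun K psi =>
  (psi a * head 0 (map psi l) < 0) = b).
Proof.
exists (s0 (a * head 0 l) < 0).
apply: near_mono (near_sign (a * head 0 l)) => K psi <-.
by rewrite sgz_lt0 rmorphM; case: l => [|b l] //=; rewrite rmorph0.
Qed.

Lemma near_changes (l : seq A) : exists n, near_signs (fun K psi =>
  changes (map psi l) = n).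
Proof.
elim: l => [|a l [n IH]]; first by exists 0%N; exact: near_all.
have [b hb] := near_head_mul l a.
by exists (b + n)%N; apply: near_mono (near_and IH hb) => K psi [/= -> ->].
Qed.

(** Sturm's theorem expresses a Tarski query by the signs of the leading coefficients
    of a signed remainder sequence, and these are constant near s0. *)
Lemma near_taqR p q : exists z : int, near_signs (fun K psi =>
  taqR (map_poly psi p) (map_poly psi q) = z).
Proof.
have [l hl] := near_mods p (p^`() * q).
have hs : {in l, forall r, near_signs (fun K psi =>
   size (map_poly psi r) = nsize r /\ lead_coef (map_poly psi r) = psi (nlead r))}.
  by move=> r _; exact: near_and (near_size r) (near_lead r).
have [n hn] := near_changes (map nlead l).
have [m hm] := near_changes [seq (-1) ^+ (~~ odd (nsize r)) * nlead r | r <- l].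
exists (m%:Z - n%:Z).
apply: near_mono (near_and (near_and hl (near_seq hs)) (near_and hn hm)).
move=> K psi [[{}hl {}hs] [<- <-]].
rewrite /taqR /changes_mods deriv_map -rmorphM hl /changes_poly.
rewrite /changes_minfty /changes_pinfty -!map_comp.
congr (_ - _); congr (Posz (changes _)); apply/eq_in_map => r /hs[/= sr lr] //.
by rewrite sr lr rmorphM rmorph_sign.
Qed.

Lemma near_poscount p sq e : exists z : int, near_signs (fun K psi =>
  poscount (rootsR (map_poly psi p)) (map (map_poly psi) sq) (map_poly psi e) = z).
Proof.
elim: sq e => [|q sq IH] e.
  by have [z hz] := near_taqR p e; exists z; apply: near_mono hz => K psi /=; rewrite taq_taqR.
have [x hx] := IH (q ^+ 2 * e); have [y hy] := IH (q * e).
exists (x + y); apply: near_mono (near_and hx hy) => K psi [/= <- <-].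
by rewrite !rmorphM.
Qed.
End Near.

Section Transfer.
Variables (A : comNzRingType) (S : rcfType) (phi : {rmorphism A -> S}).
Implicit Types (p q : {poly A}) (sq : seq {poly A}).
Let s0 a := sgz (phi a).

Lemma near_self (P : forall K : rcfType, {rmorphism A -> K} -> Prop) :
  near_signs s0 P -> P S phi.
Proof. by move=> [L]; apply. Qed.

Lemma transfer_root p sq z : map_poly phi p != 0 -> root (map_poly phi p) z ->
  {in sq, forall q, 0 < (map_poly phi q).[z]} ->
  near_signs s0 (fun K psi => exists2 x, root (map_poly psi p) x &
     {in sq, forall q, 0 < (map_poly psi q).[x]}).
Proof.
move=> p0 pz hz; have [c hc] := near_poscount s0 p sq 1.
have := near_self hc => cE.
have c0 : 0 < c.
  rewrite -cE rmorph1; apply/poscount_gt0P => //; exists z => // _ /mapP[q qsq ->].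
  exact: hz.
have szp := near_self (near_size s0 p).
apply: near_mono (near_and hc (near_size s0 p)) => K psi [{}hc sp].
have p0' : map_poly psi p != 0 by rewrite -size_poly_eq0 sp -szp size_poly_eq0.
move: c0; rewrite -hc rmorph1 => /(poscount_gt0P _ p0')[x px hx].
by exists x => // q qsq; apply: hx; apply: map_f.
Qed.

(** A point where finitely many polynomials are positive can be moved to a root of
    the derivative of their product, or to plus or minus infinity, where only
    leading coefficients matter. *)
Lemma transfer_pos sq z : {in sq, forall q, 0 < (map_poly phi q).[z]} ->
  near_signs s0 (fun K psi => exists x, {in sq, forall q, 0 < (map_poly psi q).[x]}).
Proof.
move=> hz.
have lead_case : {in sq, forall q, 0 < lead_coef (map_poly phi q)} ->
  near_signs s0 (fun K psi => exists x, {in sq, forall q, 0 < (map_poly psi q).[x]}).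
  move=> hl.
  have h : {in sq, forall q, near_signs s0 (fun K psi => 0 < lead_coef (map_poly psi q))}.
    move=> q /hl; rewrite (near_self (near_lead s0 q)) => l0.
    apply: near_mono (near_and (near_lead s0 q) (near_sign s0 (nlead s0 q))) => K psi [-> e].
    by rewrite -sgz_gt0 e /s0 sgz_gt0.
  apply: near_mono (near_seq h) => K psi {}h.
  have [|x] := (bounding_polyP (map (map_poly psi) sq)).1.
    by constructor 1; rewrite big_all all_map; apply/allP => q /h.
  by rewrite big_all all_map => /allP hx; exists x.
have [] := (bounding_polyP (map (map_poly phi) sq)).2.
- by exists z; rewrite big_all all_map; apply/allP => q /hz.
- by rewrite big_all all_map => /allP; exact: lead_case.
- rewrite big_all all_map => /allP hl.
  have h : {in sq, forall q, near_signs s0 (fun K psi =>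
      0 < (-1) ^+ (size (map_poly psi q)).-1 * lead_coef (map_poly psi q))}.
    move=> q /hl; rewrite /= (near_self (near_lead s0 q)) (near_self (near_size s0 q)) => l0.
    apply: near_mono (near_and (near_and (near_lead s0 q) (near_size s0 q))
      (near_sign s0 ((-1) ^+ (nsize s0 q).-1 * nlead s0 q))) => K psi [[-> ->] e].
    by rewrite -(rmorph_sign psi) -rmorphM -sgz_gt0 e /s0 sgz_gt0 rmorphM rmorph_sign.
  apply: near_mono (near_seq h) => K psi {}h.
  have [|x] := (bounding_polyP (map (map_poly psi) sq)).1.
    by constructor 2; rewrite big_all all_map; apply/allP => q /h.
  by rewrite big_all all_map => /allP hx; exists x.
move=> [y]; rewrite big_all all_map => /andP[/eqP by0 /allP hy].
pose b := (\prod_(q <- sq) q)^`().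
have bE : map_poly phi b = bounding_poly (map (map_poly phi) sq).
  by rewrite /bounding_poly -deriv_map rmorph_prod big_map.
have [b0|b0] := eqVneq (map_poly phi b) 0; last first.
  have /transfer_root := b0 => /(_ sq y); rewrite rootE bE by0 eqxx => /(_ isT hy).
  by apply: near_mono => K psi [x _ hx]; exists x.
apply: lead_case => q qsq.
move: b0; rewrite bE /bounding_poly.
set B := \prod_(r <- _) r => b0.
have : size B == 1%N.
  rewrite eqn_leq size_poly_gt0; apply/andP; split.
    by have := size_deriv B; rewrite b0 size_poly0; case: (size B) => [|[]].
  rewrite prodf_seq_neq0; apply/allP => _ /mapP[r rsq ->] /=.
  by apply/eqP => r0; have := hz r rsq; rewrite r0 horner0 ltxx.
move=> /size_prod_eq1 /(_ (map_poly phi q) (map_f _ qsq)) s1.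
have := hz q qsq; rewrite [map_poly phi q]size1_polyC ?s1//.
by rewrite hornerC lead_coefC.
Qed.

(** Elimination of one existential quantifier over real closed fields, in semantic
    form. *)
Theorem transfer_step (Q : seq {poly A}) z :
  near_signs s0 (fun K psi => exists x,
    {in Q, forall q, sgz (map_poly psi q).[x] = sgz (map_poly phi q).[z]}).
Proof.
pose Zs := [seq q <- Q | (map_poly phi q).[z] == 0].
pose Ps := [seq q <- Q | 0 < (map_poly phi q).[z]] ++
           [seq - q | q <- Q & (map_poly phi q).[z] < 0].
have Ppos : {in Ps, forall q, 0 < (map_poly phi q).[z]}.
  move=> q; rewrite mem_cat => /orP[|/mapP[r]]; rewrite mem_filter => /andP[//].
  by move=> r0 _ ->; rewrite rmorphN hornerN oppr_gt0.
have finish (K : rcfType) (psi : {rmorphism A -> K}) x :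
    {in Zs, forall q, (map_poly psi q).[x] = 0} ->
    {in Ps, forall q, 0 < (map_poly psi q).[x]} ->
    {in Q, forall q, sgz (map_poly psi q).[x] = sgz (map_poly phi q).[z]}.
  move=> hZ hP q qQ; case: (ltrgt0P (map_poly phi q).[z]) => hq.
  - by rewrite gtr0_sgz ?gtr0_sgz//; apply: hP; rewrite mem_cat mem_filter hq qQ.
  - rewrite ltr0_sgz ?ltr0_sgz// -oppr_gt0 -hornerN -rmorphN; apply: hP.
    rewrite mem_cat; apply/orP; right; apply/mapP; exists q => //.
    by rewrite mem_filter hq qQ.
  - by rewrite hq sgz0 hZ ?sgz0// mem_filter hq eqxx.
have [/hasP[q0 q0Z q00]|/hasPn h0] := boolP (has (fun q => map_poly phi q != 0) Zs).
  (* the roots of p are the common zeros of Zs *)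
  pose p := \sum_(q <- Zs) q ^+ 2.
  have pE (F : rcfType) (psi : {rmorphism A -> F}) x : (map_poly psi p).[x] =
      \sum_(q <- Zs) (map_poly psi q).[x] ^+ 2.
    by rewrite rmorph_sum horner_sum; apply: eq_bigr => q _; rewrite rmorphXn hornerE.
  have pz (F : rcfType) (psi : {rmorphism A -> F}) x : root (map_poly psi p) x ->
      {in Zs, forall q, (map_poly psi q).[x] = 0}.
    rewrite rootE pE psumr_eq0 => [/allP h q /h|q _]; last exact: sqr_ge0.
    by rewrite /= sqrf_eq0 => /eqP.
  have p0 : map_poly phi p != 0.
    apply: contraNneq q00 => p0.
    have rt x : root (map_poly phi q0) x.
      by rewrite rootE; apply/eqP; apply: pz q0Z; rewrite p0 root0.
    apply: contraT => /ge_cauchy_bound /(_ (cauchy_bound (map_poly phi q0))).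
    by rewrite in_itv /= lexx rt => /(_ isT).
  have := transfer_root p0 _ Ppos.
  rewrite rootE pE big_seq big1 => [/(_ (eqxx _))|q].
    by apply: near_mono => K psi [x px hx]; exists x; apply: finish => //; exact: pz.
  by rewrite mem_filter => /andP[/eqP-> _]; rewrite expr0n.
have h : {in Zs, forall q, near_signs s0 (fun K psi => map_poly psi q = 0)}.
  move=> q /h0; rewrite negbK => /eqP q0.
  apply: near_mono (near_size s0 q) => K psi sq; apply/eqP.
  by rewrite -size_poly_eq0 sq -(near_self (near_size s0 q)) q0 size_poly0.
apply: near_mono (near_and (near_seq h) (transfer_pos Ppos)) => K psi [{}h [x hx]].
by exists x; apply: finish => // q /h ->; rewrite horner0.
Qed.
End Transfer.

(** * Realizing a prime cone over a real closed field *)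

(** Integer polynomials in n variables, built one variable at a time: each step of
    the arguments below is about one more variable. Countability is
    what generic_extension needs. *)
Fixpoint tower (n : nat) : countComNzRingType :=
  if n is m.+1 then {poly (tower m)}%type else int.

Fixpoint tower_ev (W : comNzRingType) (v : nat -> W) (n : nat) : {rmorphism tower n -> W} :=
  match n return {rmorphism tower n -> W} with
  | 0 => intmul 1 : {rmorphism int -> W}
  | m.+1 => (horner_eval (v m) \o map_poly (tower_ev v m) : {rmorphism {poly tower m} -> W})
  end.

Lemma tower_evS (W : comNzRingType) (v : nat -> W) n (p : {poly tower n}) :
  tower_ev v n.+1 p = (map_poly (tower_ev v n) p).[v n].
Proof. by []. Qed.

Lemma tower_ev_morph (W W' : comNzRingType) (f : {rmorphism W -> W'}) v n (p : tower n) :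
  f (tower_ev v n p) = tower_ev (f \o v) n p.
Proof.
elim: n p => [|n IHn] p; first exact: rmorph_int.
rewrite !tower_evS -horner_map -map_poly_comp; congr _.[_].
by apply: eq_map_poly => c; exact: IHn.
Qed.

Lemma tower_ev_ext (W : comNzRingType) (v v' : nat -> W) n (p : tower n) :
  (forall k, (k < n)%N -> v k = v' k) -> tower_ev v n p = tower_ev v' n p.
Proof.
elim: n p => [|n IHn] p // h; rewrite !tower_evS h//; congr _.[_].
by apply: eq_map_poly => c; apply: IHn => k kn; apply: h; exact: ltnW.
Qed.

Lemma tower_var n k : (k < n)%N ->
  exists p : tower n, forall (W : comNzRingType) (v : nat -> W), tower_ev v n p = v k.
Proof.
elim: n => // n IHn; rewrite ltnS leq_eqVlt => /predU1P[->|/IHn[p hp]].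
  by exists 'X => W v; rewrite tower_evS map_polyX hornerX.
by exists p%:P => W v; rewrite tower_evS map_polyC hornerC; exact: hp.
Qed.

Lemma tower_widen j m (p : tower m) :
  exists q : tower (j + m), forall (W : comNzRingType) (v : nat -> W),
    tower_ev v (j + m) q = tower_ev v m p.
Proof.
elim: j => [|j [q hq]]; first by exists p.
by exists q%:P => W v; rewrite [LHS]tower_evS map_polyC hornerC; exact: hq.
Qed.

Definition set_at (W : Type) (v : nat -> W) n x k := if k == n then x else v k.

Lemma tower_ev_set_at (W : comNzRingType) (v : nat -> W) n x (p : tower n) :
  tower_ev (set_at v n x) n p = tower_ev v n p.
Proof. by apply: tower_ev_ext => k kn; rewrite /set_at ltn_eqF. Qed.

Lemma tower_ev_set_atS (W : comNzRingType) (v : nat -> W) n x (p : {poly tower n}) :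
  tower_ev (set_at v n x) n.+1 p = (map_poly (tower_ev v n) p).[x].
Proof.
rewrite tower_evS {2}/set_at eqxx; congr _.[_].
by apply: eq_map_poly => c; exact: tower_ev_set_at.
Qed.

Section PrimeConeFacts.
Variables (W : comNzRingType) (P : set W).
Hypothesis hP : is_prime_cone P.

Definition support : set W := [set w | P w /\ P (- w)].

Lemma supportD x y : support x -> support y -> support (x + y).
Proof.
by have [[PD _ _] _ _ _] := hP; move=> [? ?] [? ?]; split; rewrite ?opprD; exact: PD.
Qed.

Lemma supportM x y : support y -> support (x * y).
Proof.
have [[_ PM _] _ tot _] := hP; move=> [Py Pny].
have [Px|Pnx] := tot x; split; rewrite -?mulrN; try exact: PM.
  by rewrite -mulrNN; exact: PM.
by rewrite mulrN -mulNr; exact: PM.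
Qed.

Lemma support_int (z : int) : support z%:~R <-> z = 0.
Proof.
have [[PD PM PX] P1 tot _] := hP.
have P0 := preorder0 (And3 PD PM PX); have P1' := preorder1 (And3 PD PM PX).
have Pnat n : P n%:R by elim: n => // n IHn; rewrite mulrS; exact: PD.
split=> [|->]; last by split; rewrite ?oppr0.
have npos n : ~ P (- n.+1%:R).
  by move=> h; apply: P1; rewrite (_ : -1 = - n.+1%:R + n%:R); [exact: PD|rewrite mulrS; ring].
by case: z => [[|n]|n] // [h1 h2]; [case: (npos n)|case: (npos n)].
Qed.
End PrimeConeFacts.

Section Realization.
Variables (R : realType) (W : comNzRingType) (P : set W).
Hypothesis hP : is_prime_cone P.
Variable v : nat -> W.

(** The support of P, pulled back to integer polynomials, has a generic zero. *)
Lemma generic_point n : exists zeta : nat -> R[i], forall p : tower n,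
  support P (tower_ev v n p) <-> tower_ev zeta n p = 0.
Proof.
elim: n => [|n [zeta hz]].
  exists (fun=> 0) => p; rewrite /= support_int//; split=> [->|/eqP]; first by rewrite mulr0z.
  by rewrite intr_eq0 => /eqP.
have [|||c|t ht] := @generic_extension R (tower n) (tower_ev zeta n)
    [set p | support P (tower_ev v n.+1 p)].
- by move=> p q hp hq; rewrite /mkset rmorphD; exact: (supportD hP hp hq).
- by move=> p q hq; rewrite /mkset rmorphM; exact: (supportM hP _ hq).
- move=> p q; rewrite /mkset rmorphM; have [_ _ _ h] := hP; move=> [Pp Pn].
  by have [|] := h _ _ Pp Pn; [left|right].
- by rewrite /mkset tower_evS map_polyC hornerC; exact: hz.
by exists (set_at zeta n t) => p; rewrite tower_ev_set_atS; exact: ht.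
Qed.

(** P induces a cone on the integer polynomials in a generic zero zeta of its support.
    A maximal cone above it yields a real closed field containing the coordinates
    of zeta; totality of P shows that the signs there are those given by P. *)
Lemma real_closed_realization n : exists (S : rcfType) (sigma : nat -> S),
  forall p : tower n, P (tower_ev v n p) <-> 0 <= tower_ev sigma n p.
Proof.
have [zeta hz] := generic_point n.
have [[PD PM PX] Pm1 tot _] := hP.
pose Q : set R[i] := [set z | exists2 p : tower n, P (tower_ev v n p) & z = tower_ev zeta n p].
have hQ : precone Q.
  have P1 := preorder1 (And3 PD PM PX).
  split.
  - by exists 1; rewrite rmorph1.
  - by move=> _ _ [p Pp ->] [q Pq ->]; exists (p + q); rewrite rmorphD//; exact: PD.
  - by move=> _ _ [p Pp ->] [q Pq ->]; exists (p * q); rewrite rmorphM//; exact: PM.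
  - move=> _ [_ [_ [[p Pp ->] [q Pq ->] ->]]]; exists ((p - q) ^+ 2).
      by rewrite rmorphXn; exact: PX.
    by rewrite -rmorphB rmorphXn.
  - move=> _ [p Pp ->] [q Pq e]; apply/hz; split=> //.
    have [_] : support P (tower_ev v n (p + q)) by apply/hz; rewrite rmorphD /= -e subrr.
    by rewrite rmorphD opprD => h; rewrite -[X in P X](subrK (tower_ev v n q)); exact: PD.
have [C' maxC QC] := maximal_precone_extension hQ.
pose C := RealCone maxC.
have hC p : P (tower_ev v n p) -> C' (tower_ev zeta n p).
  by move=> h; apply: QC; exists p.
have inF p : tower_ev zeta n p \in in_cone_field C.
  apply/in_cone_fieldP.
  have [h|h] := tot (tower_ev v n p); first by apply: (sub_diff_set maxC.1); exact: hC.
  rewrite -[tower_ev zeta n p]opprK; apply: diff_setN.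
  apply: (sub_diff_set maxC.1); rewrite -rmorphN; apply: hC; by rewrite rmorphN.
exists (cone_field C), (fun k => insubd 0 (zeta k)) => p.
have val_ev : val (tower_ev (fun k => insubd (0 : cone_field C) (zeta k)) n p) = tower_ev zeta n p.
  rewrite tower_ev_morph; apply: tower_ev_ext => k kn /=; rewrite insubdK//.
  by have [q <-] := tower_var kn; exact: inF.
split=> [/hC h|/cf_ge0P]; first by apply/cf_ge0P; rewrite val_ev.
rewrite val_ev => h.
have [//|Pn] := tot (tower_ev v n p).
have : tower_ev zeta n p = 0.
  apply: (precone_anti maxC.1) => //; rewrite -rmorphN; apply: hC; by rewrite rmorphN.
by move/hz => [].
Qed.
End Realization.

Section TowerTransfer.
Variables (R S : rcfType) (sigma : nat -> S) (c : nat -> R) (m : nat).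
Hypothesis base : forall p : tower m, sgz (tower_ev c m p) = sgz (tower_ev sigma m p).

(** transfer_step repeated j times, from the last variable down. *)
Lemma tower_transfer j (L : seq (tower (j + m))) : exists2 r : nat -> R,
  forall k, (k < m)%N -> r k = c k &
  {in L, forall p, sgz (tower_ev r (j + m) p) = sgz (tower_ev sigma (j + m) p)}.
Proof.
elim: j L => [|j IHj] L; first by exists c => // p _; exact: base.
have [L' hL'] := transfer_step (tower_ev sigma (j + m)) L (sigma (j + m)%N).
have [r rc hr] := IHj L'.
have [x hx] := hL' R (tower_ev r (j + m)) hr.
exists (set_at r (j + m) x) => [k km|p pL].
  by rewrite /set_at ltn_eqF ?rc// (leq_trans km)// leq_addl.
by rewrite [tower_ev _ _ p]tower_ev_set_atS hx.
Qed.
End TowerTransfer.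

(** * The weak Positivstellensatz *)

Section MpolyPreorder.
Variables (R : realType) (d : nat).
Notation W := {mpoly R[d]}.
Implicit Types (T : set W) (p q f g h s t : W) (a b c : R).

Lemma mpoly_gen_ind (Q : W -> Prop) :
  (forall c, Q (mpolyC d c)) -> (forall i : 'I_d, Q (mpolyX R (mnm1 i))) ->
  (forall p q, Q p -> Q q -> Q (p + q)) -> (forall p q, Q p -> Q q -> Q (p * q)) ->
  forall p, Q p.
Proof.
move=> QC QX QD QM; elim/mpolyind => [|c m p _ _ Qp]; first by rewrite -mpolyC0.
apply: (QD) => //; rewrite -mul_mpolyC; apply: (QM) => //.
rewrite mpolyXE_id; apply: big_ind => [|p1 p2|i _]; [exact: QC|exact: QM|].
elim: (m i) => [|n IHn]; first by rewrite expr0 -mpolyC1.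
by rewrite exprS; exact: QM.
Qed.

(** Nonnegative constants are squares. *)
Lemma preorder_const T c : is_preorder T -> 0 <= c -> T (mpolyC d c).
Proof. by case=> _ _ TX c0; rewrite -(sqr_sqrtr c0) rmorphXn; exact: TX. Qed.

Lemma prime_cone_const T c : is_prime_cone T -> T (mpolyC d c) <-> 0 <= c.
Proof.
move=> hT; have [hP T1 _ _] := hT; split=> [Tc|]; last exact: preorder_const.
rewrite leNgt; apply/negP => c0; apply: T1.
have -> : -1 = (mpolyC d c) * (mpolyC d (- c^-1)) :> W.
  by rewrite -mpolyCM mulrN mulfV ?lt_eqF// mpolyCN mpolyC1.
have [_ TM _] := hP; apply: TM => //; apply: preorder_const => //.
by rewrite oppr_ge0 invr_le0 ltW.
Qed.

(** All coefficients of the polynomials in l are turned into the first m variables v k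
    of an integer polynomial ring, the variables of the polynomials are the last d
    ones. A prime cone determines the order of the constants, so the coefficients
    have over S the signs that they have in R, and tower_transfer extends them by a
    real point. *)
Theorem weak_positivstellensatz T (l : seq W) : is_preorder T ->
  {in l, forall f, T f} -> ~ T (-1) ->
  exists x : 'rV[R]_d, {in l, forall f, 0 <= mpeval f x}.
Proof.
move=> hT lT T1; have [P hP TP] := prime_cone_extension hT T1.
pose cs : seq R := flatten [seq [seq mcoeff m f | m <- msupp f] | f : W <- l].
pose m := size cs; pose n := (d + m)%N.
pose v k : W := if (k < m)%N then (mpolyC d (cs`_k))
                else if insub (k - m)%N is Some i then mpolyX R (mnm1 (i : 'I_d)) else 0.
have vX (i : 'I_d) : v (i + m)%N = mpolyX R (mnm1 i).
  by rewrite /v ltnNge leq_addl /= addnK insubT //= => ?; congr (mpolyX R (mnm1 _)); exact: val_inj.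
pose rep (f : W) := exists p : tower n, tower_ev v n p = f.
have repD f g : rep f -> rep g -> rep (f + g).
  by move=> [p <-] [q <-]; exists (p + q); rewrite rmorphD.
have repM f g : rep f -> rep g -> rep (f * g).
  by move=> [p <-] [q <-]; exists (p * q); rewrite rmorphM.
have rep_v k : (k < n)%N -> rep (v k).
  by move=> kn; have [p hp] := tower_var kn; exists p; exact: hp.
have repX i : rep (mpolyX R (mnm1 i)) by rewrite -vX; apply: rep_v; rewrite ltn_add2r.
have repl f : f \in l -> rep f.
  move=> fl; rewrite (mpolyE f) big_seq; apply: big_ind => //.
    by exists 0; rewrite rmorph0.
  move=> mm mf; rewrite -mul_mpolyC; apply: (repM).
    have cin : (mcoeff mm f) \in cs by apply/flatten_mapP; exists f => //; exact: map_f.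
    have kn : (index (mcoeff mm f) cs < m)%N by rewrite index_mem.
    have := rep_v (index (mcoeff mm f) cs); rewrite /v kn nth_index//.
    by apply; rewrite (leq_trans kn)// leq_addl.
  rewrite mpolyXE_id; apply: big_ind => //; first by exists 1; rewrite rmorph1.
  move=> i _; elim: (mm i) => [|e IHe]; first by exists 1; rewrite rmorph1 expr0.
  by rewrite exprS; exact: repM.
have [S [sigma hS]] := real_closed_realization R hP v n.
pose c k := cs`_k.
have ge0 (p : tower m) : (0 <= tower_ev c m p) = (0 <= tower_ev sigma m p).
  have [q hq] := tower_widen d p.
  have -> : tower_ev sigma m p = tower_ev sigma n q by rewrite -hq.
  have : (mpolyC d (tower_ev c m p)) = tower_ev v n q :> W.
    rewrite hq (tower_ev_morph (@mpolyC d R : {rmorphism R -> W})); apply: tower_ev_ext => k km.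
    by rewrite /v km.
  move=> e; apply/idP/idP => [h|/hS]; first by apply/hS; rewrite -e; apply/prime_cone_const.
  by rewrite -e => /(prime_cone_const _ hP).
have base (p : tower m) : sgz (tower_ev c m p) = sgz (tower_ev sigma m p).
  have := ge0 p; have := ge0 (- p); rewrite !rmorphN !oppr_ge0.
  by case: sgzP => hp; case: sgzP => // hs; rewrite ?hp ?hs ?lexx ?(ltW hp) ?(ltW hs) ?(leNgt _ 0) ?(leNgt 0) ?hp ?hs.
pose pre (f : W) : tower n := xget 0 [set p | tower_ev v n p = f].
have preE f : f \in l -> tower_ev v n (pre f) = f.
  by move=> /repl[p hp]; rewrite /pre; case: xgetP => [_ ->//|/(_ p)].
have [r rc hr] := @tower_transfer R S sigma c m base d (map pre l).
exists (\row_(i < d) r (i + m)%N) => f fl.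
have -> : mpeval f (\row_(i < d) r (i + m)%N) = tower_ev r n (pre f).
  rewrite -{1}(preE f fl) /mpeval tower_ev_morph; apply: tower_ev_ext => k kn /=.
  rewrite /v; case: ltnP => km; first by rewrite mevalC rc.
  have kd : (k - m < d)%N by rewrite ltn_subLR// addnC.
  by rewrite insubT /= mevalXU mxE /= subnK.
rewrite -sgz_ge0 hr ?map_f// sgz_ge0; apply/hS; rewrite preE//.
by apply: TP; exact: lT.
Qed.
End MpolyPreorder.

(** * Archimedean preorderings *)

Section Archimedean.
Variables (R : realType) (d : nat).
Notation W := {mpoly R[d]}.
Notation cst c := (@mpolyC d R c).
Notation var i := (mpolyX R (mnm1 i)).
Implicit Types (T : set W) (p q f g h s t : W) (a b c : R).

Definition bounded_in T p := exists a, T (cst a - p) /\ T (cst a + p).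

Definition sqnorm : W := \sum_(i < d) var i ^+ 2.

Lemma preorder_sum T (I : Type) (r : seq I) (Q : pred I) (F : I -> W) :
  is_preorder T -> (forall i, Q i -> T (F i)) -> T (\sum_(i <- r | Q i) F i).
Proof.
move=> hT h; have T0 := preorder0 hT; case: hT => TD _ _.
by apply: big_ind.
Qed.

Lemma bounded_const T c : is_preorder T -> bounded_in T (cst c).
Proof.
move=> hT; exists `|c|; rewrite -mpolyCB -mpolyCD; split; apply: preorder_const => //.
  by rewrite subr_ge0 ler_norm.
by rewrite -[X in _ + X]opprK subr_ge0 -normrN ler_norm.
Qed.

Lemma boundedD T p q : is_preorder T -> bounded_in T p -> bounded_in T q ->
  bounded_in T (p + q).
Proof.
case=> TD _ _ [a [pa pa']] [b [qb qb']]; exists (a + b); rewrite mpolyCD; split.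
  by rewrite opprD addrACA; exact: TD.
by rewrite addrACA; exact: TD.
Qed.

Lemma boundedM T p q : is_preorder T -> bounded_in T p -> bounded_in T q ->
  bounded_in T (p * q).
Proof.
move=> hT [a [pa pa']] [b [qb qb']]; exists (a * b).
have half x : T (x + x) -> T x.
  move=> Txx; have -> : x = cst 2^-1 * (x + x).
    by rewrite -mulr2n -[x *+ 2]mulr_natl mulrA -(mpolyC_nat d) -mpolyCM mulVf ?pnatr_eq0// mpolyC1 mul1r.
  by case: (hT) => _ TM _; apply: TM => //; apply: preorder_const => //; rewrite invr_ge0 ler0n.
have [TD TM _] := hT; rewrite mpolyCM; split; apply: half.
  have -> : cst a * cst b - p * q + (cst a * cst b - p * q) =
    (cst a - p) * (cst b + q) + (cst a + p) * (cst b - q) by ring.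
  by apply: TD; exact: TM.
have -> : cst a * cst b + p * q + (cst a * cst b + p * q) =
  (cst a + p) * (cst b + q) + (cst a - p) * (cst b - q) by ring.
by apply: TD; exact: TM.
Qed.

(** Bounded elements form a subring, and N + 1/4 + x_i is the sum of N - |x|^2, of the
    other squares x_j^2, and of (x_i + 1/2)^2. *)
Lemma archimedean_preorder T N : is_preorder T -> T (cst N - sqnorm) ->
  forall p, bounded_in T p.
Proof.
move=> hT TN; apply: mpoly_gen_ind => [c|i|p q|p q].
- exact: bounded_const.
- have [TD TM TX] := hT.
  (* e is a sign: both bounds at once *)
  have key e : e ^+ 2 = 1 -> T (cst (N + 4^-1) - e * var i).
    move=> e1; have -> : cst (N + 4^-1) - e * var i =
        (cst N - sqnorm) + (\sum_(j < d | j != i) var j ^+ 2 + (var i - cst 2^-1 * e) ^+ 2).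
      rewrite /sqnorm (bigD1 i) //= sqrrB exprMn e1 mulr1 -rmorphXn mpolyCD.
      have -> : 2^-1 ^+ 2 = 4^-1 :> R by rewrite exprVn -natrX.
      have -> : var i * (cst 2^-1 * e) *+ 2 = e * var i.
        by rewrite mulrCA -mulrnAl -rmorphMn /= -[2^-1 *+ 2]mulr_natr mulVf ?pnatr_eq0// mpolyC1 mul1r mulrC.
      ring.
    apply: (TD) => //; apply: (TD) => //.
    by apply: preorder_sum => // j _; exact: TX.
  exists (N + 4^-1); split; first by rewrite -[var i]mul1r; apply: key; rewrite expr1n.
  by rewrite -[var i]opprK -[- var i]mulN1r; apply: key; rewrite sqrrN expr1n.
- exact: boundedD.
- exact: boundedM.
Qed.

Lemma sos_preorder : is_preorder (@sos R d).
Proof.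
have sosX p : sos (p ^+ 2) by exists [:: p]; rewrite big_seq1.
have sosD p q : sos p -> sos q -> sos (p + q).
  by move=> [l ->] [l' ->]; exists (l ++ l'); rewrite big_cat.
split=> // p q [l ->] [l' ->]; exists [seq u * v | u <- l, v <- l'].
rewrite big_allpairs_dep mulr_suml; apply: eq_bigr => u _.
by rewrite mulr_sumr; apply: eq_bigr => v _; rewrite exprMn.
Qed.

(** Woermann's trick. The preordering generated by g = N - |x|^2 alone is archimedean,
    so k - s = a + g b with sums of squares a, b. Since (1 + s) g = t g^2 is in T,
    so is (1 + s) (k - s), and completing the square bounds s in T. Then
    N (1 + s) - |x|^2 = (1 + s) g + s |x|^2 bounds |x|^2. *)
Lemma archimedean_of_bounded T s t N : is_preorder T -> T s -> T t -> 0 <= N ->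
  t * (cst N - sqnorm) = 1 + s -> exists N', T (cst N' - sqnorm).
Proof.
move=> hT Ts Tt N0; set g := cst N - sqnorm => tg; have [TD TM TX] := hT.
have Tsos p : sos p -> T p.
  by move=> [l ->]; apply: preorder_sum => // q _; exact: TX.
have hsos := sos_preorder.
have hG := preorder_adjoin g hsos.
have [k [[a [b [sa sb kE]]] _]] := archimedean_preorder hG (mem_adjoin g hsos) s.
have Tk : T (cst (4^-1 * k ^+ 2 + k) - s).
  have -> : cst (4^-1 * k ^+ 2 + k) - s = (1 + s) * (cst k - s) + (cst (2^-1 * k) - s) ^+ 2.
    have h2 : cst k = cst (2^-1 * k) + cst (2^-1 * k).
      by rewrite -mpolyCD; congr (mpolyC d _); lra.
    have h4 : cst (4^-1 * k ^+ 2) = cst (2^-1 * k) ^+ 2.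
      by rewrite -rmorphXn exprMn exprVn -natrX.
    rewrite mpolyCD h4.
    transitivity (cst (2^-1 * k) ^+ 2 + cst k - s +
      s * (cst k - (cst (2^-1 * k) + cst (2^-1 * k)))); first by rewrite -h2 subrr mulr0 addr0.
    ring.
  apply: (TD) => //; rewrite kE mulrDr mulrA; apply: (TD).
    apply: (TM); last exact: Tsos.
    by apply: (TD) => //; exact: preorder1.
  apply: (TM); last exact: Tsos.
  by rewrite -tg -mulrA -expr2; apply: (TM).
exists (N * (1 + (4^-1 * k ^+ 2 + k))).
have -> : cst (N * (1 + (4^-1 * k ^+ 2 + k))) - sqnorm =
  (t * g * g + s * sqnorm) + cst N * (cst (4^-1 * k ^+ 2 + k) - s).
  by rewrite tg /g mpolyCM [cst (1 + _)]mpolyCD mpolyC1; ring.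
apply: (TD); last by apply: (TM) => //; exact: preorder_const.
apply: (TD); first by rewrite -mulrA -expr2; exact: TM.
by apply: (TM) => //; apply: preorder_sum => // i _; exact: TX.
Qed.

(** With n large, n^2 (h + r) - 1 is the sum of (n - t)^2 (h + r), 2 n (t h - 1),
    r t (2 n - t) and 2 n - 1 - t^2 h, all in T when r >= 0. So r can be lowered by
    1 / n^2 at each step. *)
Lemma positive_of_archimedean T s t h : is_preorder T -> (forall p, bounded_in T p) ->
  T s -> T t -> t * h = 1 + s -> T h.
Proof.
move=> hT bT Ts Tt th; have [TD TM TX] := hT.
have larger a b p : a <= b -> T (cst a + p) -> T (cst b + p).
  move=> ab h1; have -> : cst b + p = cst (b - a) + (cst a + p) by rewrite mpolyCB; ring.
  by apply: (TD) => //; apply: preorder_const => //; rewrite subr_ge0.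
have [a [ta _]] := bT t; have [b [thb _]] := bT (t ^+ 2 * h); have [r0 [_ hr0]] := bT h.
pose n := Num.max 1 (Num.max a (b + 1)).
have n1 : 1 <= n by rewrite le_max lexx.
have n0 : 0 < n by exact: lt_le_trans ltr01 n1.
have Tt' : T (cst (2 * n) - t).
  apply: larger ta; rewrite (le_trans (_ : a <= n)) ?le_max ?lexx ?orbT//.
  by rewrite ler_peMl ?(ltW n0)// ler1n.
have Tth : T (cst (2 * n - 1) - t ^+ 2 * h).
  apply: larger thb; have : b + 1 <= n by rewrite !le_max lexx !orbT.
  lra.
have step r : 0 <= r -> T (cst r + h) -> T (cst (r - n ^- 2) + h).
  move=> r0' Tr.
  have -> : cst (r - n ^- 2) + h = cst (n ^- 2) *
    ((cst n - t) ^+ 2 * (cst r + h) + cst (2 * n) * s + cst r * t * (cst (2 * n) - t) +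
     (cst (2 * n - 1) - t ^+ 2 * h)).
    have -> : s = t * h - 1 by rewrite th addrC addKr.
    have e : cst (n ^- 2) * cst n ^+ 2 = 1.
      by rewrite -rmorphXn -mpolyCM mulVf ?mpolyC1// expf_neq0// gt_eqF.
    transitivity (cst (n ^- 2) * (cst n ^+ 2 * (cst r + h) - 1)).
      by rewrite mulrBr mulrA e mul1r mulr1 mpolyCB; ring.
    by rewrite mpolyCB mpolyCM mpolyC1 -[2]/(2%:R) mpolyC_nat; ring.
  apply: (TM); first by apply: preorder_const => //; rewrite invr_ge0 exprn_ge0// ltW.
  apply: (TD) => //; apply: (TD); last first.
    by apply: (TM) => //; apply: (TM) => //; exact: preorder_const.
  apply: (TD); first by apply: (TM) => //; exact: TX.
  by apply: (TM) => //; apply: preorder_const => //; rewrite mulr_ge0// ltW.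
have iter m : T h \/ T (cst (r0 - m%:R * n ^- 2) + h).
  elim: m => [|m [IH|IH]]; [by right; rewrite mul0r subr0|by left|].
  have [r_ge0|r_lt0] := lerP 0 (r0 - m%:R * n ^- 2).
    by right; rewrite -natr1 mulrDl mul1r opprD addrA; exact: step.
  by left; rewrite -[h]add0r -mpolyC0; apply: larger IH; exact: ltW.
have [m hm] : exists m : nat, r0 < m%:R * n ^- 2.
  exists (Num.bound `|r0 * n ^+ 2|).
  by rewrite ltr_pdivlMr ?exprn_gt0// (le_lt_trans (ler_norm _))// archi_boundP.
have [//|hm'] := iter m.
by rewrite -[h]add0r -mpolyC0; apply: larger hm'; rewrite subr_le0 ltW.
Qed.
End Archimedean.

(** * Compact basic closed semialgebraic sets *)

Section Schmuedgen.
Variables (R : realType) (d k : nat) (f : 'I_k -> {mpoly R[d]}).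
Notation W := {mpoly R[d]}.
Let prodf (e : {ffun 'I_k -> bool}) : W := \prod_(i < k) f i ^+ e i.

Lemma preorderingD p q : preordering f p -> preordering f q -> preordering f (p + q).
Proof.
move=> [sg hsg ->] [tu htu ->]; exists (fun e => sg e + tu e).
  by move=> e; have [sD _ _] := sos_preorder R d; exact: sD.
by rewrite -big_split; apply: eq_bigr => e _; rewrite mulrDr.
Qed.

Lemma preordering_term e s : sos s -> preordering f (prodf e * s).
Proof.
have s0 := preorder0 (sos_preorder R d).
move=> ss; exists (fun e' => if e' == e then s else 0); first by move=> e'; case: ifP.
rewrite (bigD1 e) //= eqxx [X in _ + X]big1 ?addr0// => e' /negPf ->.
by rewrite mulr0.
Qed.

Lemma preordering0 : preordering f 0.
Proof.
by rewrite -(mulr0 (prodf [ffun=> false])); apply/preordering_term/(preorder0 (sos_preorder R d)).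
Qed.

(** Common factors of two products of generators contribute squares. *)
Lemma prodfM e e' : prodf e * prodf e' =
  prodf [ffun i => e i (+) e' i] * prodf [ffun i => e i && e' i] ^+ 2.
Proof.
rewrite /prodf -big_split -prodrXl -big_split; apply: eq_bigr => i _ /=.
by rewrite !ffunE; case: (e i); case: (e' i); rewrite /= ?expr0 ?expr1n ?expr1 ?mul1r ?mulr1 ?expr2.
Qed.

Lemma preordering_is_preorder : is_preorder (preordering f).
Proof.
have [sD sM sX] := sos_preorder R d.
split=> [p q|p q [sg hsg ->] [tu htu ->]|p]; first exact: preorderingD.
  rewrite mulr_suml; apply: big_ind => [||e _]; [exact: preordering0|exact: preorderingD|].
  rewrite mulr_sumr; apply: big_ind => [||e' _]; [exact: preordering0|exact: preorderingD|].
  rewrite -/(prodf e) -/(prodf e') mulrACA prodfM -mulrA; apply: preordering_term.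
  by apply: (sM) => //; exact: sM.
have -> : p ^+ 2 = prodf [ffun=> false] * p ^+ 2.
  by rewrite /prodf big1 ?mul1r// => i _; rewrite ffunE expr0.
exact: preordering_term.
Qed.

Lemma preordering_gen i : preordering f (f i).
Proof.
have -> : f i = prodf [ffun j => j == i] * 1 ^+ 2.
  rewrite /prodf (bigD1 i) //= big1 ?ffunE ?eqxx ?expr1n ?mulr1// => j /negPf ji.
  by rewrite ffunE ji expr0.
by apply: preordering_term; have [_ _] := sos_preorder R d; apply.
Qed.

(** The preordering generated by that of f and - g has no points, so it contains -1. *)
Lemma positive_certificate g : (forall x : 'rV[R]_d, semialg f x -> 0 < mpeval g x) ->
  exists s t, [/\ preordering f s, preordering f t & t * g = 1 + s].
Proof.
move=> gpos; have hT := preordering_is_preorder.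
have hA := preorder_adjoin (- g) hT.
have [[s [t [Ts Tt e]]]|nA] := pselect (adjoin (preordering f) (- g) (-1)).
  exists s, t; split=> //.
  by rewrite -[1]opprK e; ring.
have [x hx] : exists x : 'rV[R]_d, {in - g :: codom f, forall p, 0 <= mpeval p x}.
  apply: weak_positivstellensatz hA _ nA => p; rewrite inE => /predU1P[->|/codomP[i ->]].
    exact: mem_adjoin.
  by apply: sub_adjoin => //; exact: preordering_gen.
have := hx (- g) (mem_head _ _); rewrite /mpeval mevalN oppr_ge0 leNgt gpos// => i.
by apply: hx; rewrite inE codom_f orbT.
Qed.

Lemma compact_sqnorm_lt : compact (semialg f) -> exists2 N : R, 0 <= N &
  forall x : 'rV[R]_d, semialg f x -> 0 < mpeval (mpolyC d N - sqnorm R d) x.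
Proof.
move=> /compact_bounded /ex_strict_bound_gt0[M M0 hM].
exists (d%:R * M ^+ 2 + 1) => [|x /hM /= xM].
  by rewrite addr_ge0// mulr_ge0// sqr_ge0.
rewrite /mpeval mevalB mevalC subr_gt0 /sqnorm rmorph_sum /=.
apply: (@le_lt_trans _ _ (\sum_(i < d) M ^+ 2)); last first.
  by rewrite sumr_const card_ord [X in _ < X + _]mulr_natl ltrDl.
apply: ler_sum => i _; rewrite rmorphXn /= mevalXU -real_normK ?num_real//.
rewrite lerXn2r ?nnegrE ?(ltW M0)//.
apply: le_trans (ltW xM).
rewrite /Num.norm /= mx_normrE.
exact: (le_bigmax (0 : R) (fun ij : 'I_1 * 'I_d => `|x ij.1 ij.2|) (ord0, i)).
Qed.

End Schmuedgen.

Theorem theorem12p28 (R : realType) (d k : nat)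
  (f : 'I_k -> {mpoly R[d]}) (h : {mpoly R[d]}) :
  compact (semialg f) ->
  (forall x : 'rV[R]_d, semialg f x -> 0 < mpeval h x) ->
  preordering f h.
Proof.
move=> cK hpos; have hT := preordering_is_preorder f.
have [N N0 hN] := compact_sqnorm_lt cK.
have [s [t [Ts Tt e]]] := positive_certificate hN.
have [N' TN'] := archimedean_of_bounded hT Ts Tt N0 e.
have [s' [t' [Ts' Tt' e']]] := positive_certificate hpos.
exact: (positive_of_archimedean hT (archimedean_preorder hT TN') Ts' Tt' e').
Qed.
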